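(* Let $k$ be a field, let $\Lambda$ be a finite dimensional hereditary basic split $k$-algebra, and let $\Lambda\simeq T(\mathcal{S}_m)/\langle\rho\rangle$ where $\mathcal{S}_m$ is a $k$-species whose underlying quiver $Q_{\mathcal{S}_m}$ is finite and without oriented cycles and $\rho$ is a strong canonical set of relations on $\mathcal{S}_m$. If the underlying graph of $\mathcal{S}_m$ is a tree, then $\Lambda\simeq T(\mathcal{S}_m)\simeq T(\mathcal{S}_\Lambda)$, where $\mathcal{S}_\Lambda$ is the species of $\Lambda$.
   Context: Algebras. $\mathfrak{r} = \operatorname{rad}\Lambda$ is the Jacobson radical. $\Lambda$ is basic if ${}_\Lambda\Lambda$ is a direct sum of pairwise non-isomorphic indecomposable projective left modules; then $\Lambda/\mathfrak{r} \simeq \bigoplus_{i\in I} D_i$ with $D_i$ division rings. $\Lambda$ is split if there is a $k$-algebra homomorphism $\epsilon\colon \Lambda/\mathfrak{r} \to \Lambda$ with $\pi\epsilon = \operatorname{id}_{\Lambda/\mathfrak{r}}$, where $\pi\colon\Lambda\to\Lambda/\mathfrak{r}$ is the natural projection. $\Lambda$ is hereditary if all left ideals are projective. Species. A $k$-species $\mathcal{S} = (D_i, {}_jM_i)_{i,j\in I}$ consists of division rings $D_i$, finite dimensional over a common central subfield $k$, and $D_j$-$D_i$-bimodules ${}_jM_i$, finite dimensional over $k$ with $\lambda m = m\lambda$ for $\lambda \in k$, $m\in {}_jM_i$. (Then automatically $\operatorname{Hom}_{D_i}({}_jM_i,D_i)\simeq \operatorname{Hom}_{D_j}({}_jM_i,D_j)$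 as $D_i$-$D_j$-bimodules.) Its underlying quiver $Q_\mathcal{S}$ has vertex set $I$ and one arrow $i\to j$ for each ${}_jM_i\neq (0)$. The underlying graph of $\mathcal{S}$ is the graph obtained from $Q_\mathcal{S}$ by forgetting orientations; it is called a tree if it does not contain any cycles. Put $D = \bigoplus_i D_i$, $M = \bigoplus_{i,j} {}_jM_i$ (a $D$-$D$-bimodule), $M^{(0)} = D$, and $M^{(n)}$ the $n$-fold tensor product of $M$ over $D$. The tensor algebra is $T(\mathcal{S}) = \bigoplus_{n\ge 0} M^{(n)}$ with multiplication given by the tensor product. The species of $\Lambda$ is $\mathcal{S}_\Lambda = (D_i, {}_jM_i)_{i,j\in I}$ with $\Lambda/\mathfrak{r}\simeq\bigoplus_{i\in I} D_i$ and ${}_jM_i = D_j(\mathfrak{r}/\mathfrak{r}^2)D_i$. Relations. A relation on $\mathcal{S}$ starting in $a\in I$ and ending in $b\in I$ is a finite sum $\sigma = g_1+\cdots+g_n$ where each $g_l = g_{l,n_l}\otimes\cdots\otimes g_{l,1}$, $n_l\ge 1$, is an elementary tensor in ${}_{i_{n_l}}M_{i_{n_l-1}}\otimes_{D_{i_{n_l-1}}}\cdots\otimes_{D_{i_1}} {}_{i_1}M_{i_0}$ for some path $a=i_0\to\cdots\to i_{n_l}=b$ (depending on $l$) in $Q_\mathcal{S}$. For a set of relations or a single element, $\langle\cdot\rangle$ denotes the two-sided ideal of $T(\mathcal{S})$ generated. Canonical relations. Let $Q_\mathcal{S}$ be finite and without oriented cycles. A relation $\sigma=g_1+\cdots+g_n$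 from $i$ to $j$ is a canonical relation if exactly one summand lies in ${}_jM_i$, i.e. $g_l\in{}_jM_i$ and $g_k\notin{}_jM_i$ for all $k\ne l$; after renumbering $l=1$. It is a strong canonical relation if moreover $n>1$. A set $\rho=\{\sigma_t\}_{t\in T}$ is a strong canonical set of relations if (1) all $\sigma_t$ are strong canonical relations, and (2) whenever $\{\sigma_t\}_{t\in T'}$ is the set of relations in $\rho$ starting in $i$ and ending in $j$ and $\{g^t_1\}_{t\in T'}$ is the corresponding set of summands lying in ${}_jM_i$, then $\langle g^t_1\rangle\cap\langle g^{t'}_1\rangle=(0)$ for all $t\neq t'$. *)

(* Defs.v *)
From HB Require Import structures.
From mathcomp Require Import all_boot all_algebra falgebra.
From mathcomp Require Import boolp.
From mathcomp Require Import freeg.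

Set Implicit Arguments.
Unset Strict Implicit.
Unset Printing Implicit Defensive.

Import GRing.Theory.
Local Open Scope ring_scope.
Local Open Scope quotient_scope.

(* Unital associative algebras over a field, as rings with a central structure
   map.  Unlike [algType k], the zero algebra is allowed: a quotient or a tensor
   algebra may vanish. *)
HB.mixin Record isKAlgebra (k : fieldType) A of GRing.PzRing A := {
  kstr : {rmorphism k -> A};
  kstrC : forall (c : k) (x : A), kstr c * x = x * kstr c
}.
#[short(type="kalgType")]
HB.structure Definition KAlgebra (k : fieldType) :=
  {A of GRing.PzRing A & isKAlgebra k A}.

Section FalgKAlgebra.
Variables (k : fieldType) (A : falgType k).
Fact falg_kstrC (c : k) (x : A) : c%:A * x = x * c%:A.
Proof. by rewrite -scalerAl -scalerAr mul1r mulr1. Qed.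
HB.instance Definition _ :=
  isKAlgebra.Build k (Falgebra.sort A)
    (kstr := GRing.RMorphism.clone _ _ (in_alg A) _) falg_kstrC.
End FalgKAlgebra.

Definition alg_hom (k : fieldType) (A B : kalgType k) (f : {rmorphism A -> B}) :=
  forall c : k, f (kstr c) = kstr c.

Definition alg_iso (k : fieldType) (A B : kalgType k) : Prop :=
  exists f : {rmorphism A -> B}, alg_hom f /\ bijective f.


Definition zspan (V : zmodType) (X : V -> Prop) : {pred V} :=
  fun x => `[< forall H : {pred V}, zmod_closed H ->
                 (forall y, X y -> y \in H) -> x \in H >].

Section Zspan.
Variables (V : zmodType) (X : V -> Prop).

Lemma zspanP x : reflect
  (forall H : {pred V}, zmod_closed H -> (forall y, X y -> y \in H) -> x \in H)
  (x \in zspan X).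
Proof. exact: asboolP. Qed.

Lemma zspan_gen x : X x -> x \in zspan X.
Proof. by move=> Xx; apply/zspanP => H _; apply. Qed.

Fact zspan_zmod_closed : zmod_closed (zspan X).
Proof.
split=> [|x y /zspanP Hx /zspanP Hy]; apply/zspanP => H HH XH.
  by case: HH.
by case: (HH) => _; apply; [apply: Hx | apply: Hy].
Qed.
HB.instance Definition _ := GRing.isZmodClosed.Build V (zspan X) zspan_zmod_closed.
End Zspan.

HB.mixin Record isIdeal2 (A : pzRingType) (S : {pred A}) := {
  ideal2Ml : forall a x : A, x \in S -> a * x \in S;
  ideal2Mr : forall a x : A, x \in S -> x * a \in S
}.
#[short(type="ideal2")]
HB.structure Definition Ideal2 (A : pzRingType) :=
  {S of GRing.ZmodClosed A S & isIdeal2 A S}.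

Definition ideal_gen (A : pzRingType) (X : A -> Prop) : {pred A} :=
  fun x => `[< forall I : ideal2 A, (forall y, X y -> y \in I) -> x \in I >].

Section IdealGen.
Variables (A : pzRingType) (X : A -> Prop).

Lemma ideal_genP x : reflect
  (forall I : ideal2 A, (forall y, X y -> y \in I) -> x \in I)
  (x \in ideal_gen X).
Proof. exact: asboolP. Qed.

Fact ideal_gen_zmod_closed : zmod_closed (ideal_gen X).
Proof.
split=> [|x y /ideal_genP Hx /ideal_genP Hy]; apply/ideal_genP => I XI.
  exact: rpred0.
by rewrite rpredB ?Hx ?Hy.
Qed.
HB.instance Definition _ :=
  GRing.isZmodClosed.Build A (ideal_gen X) ideal_gen_zmod_closed.

Fact ideal_genMl a x : x \in ideal_gen X -> a * x \in ideal_gen X.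
Proof.
by move=> /ideal_genP Hx; apply/ideal_genP => I XI; rewrite ideal2Ml ?Hx.
Qed.
Fact ideal_genMr a x : x \in ideal_gen X -> x * a \in ideal_gen X.
Proof.
by move=> /ideal_genP Hx; apply/ideal_genP => I XI; rewrite ideal2Mr ?Hx.
Qed.
HB.instance Definition _ := isIdeal2.Build A (ideal_gen X) ideal_genMl ideal_genMr.
End IdealGen.

Definition quot_alg (A : pzRingType) (I : ideal2 A) : Type := Quotient.quot I.

Section QuotRing.
Variables (A : pzRingType) (I : ideal2 A).
Notation Q := (quot_alg I).

HB.instance Definition _ := GRing.Zmodule.on Q.

Definition qpi (x : A) : Q := \pi_(Quotient.quot I) x.

Lemma qpi_surj (y : Q) : exists x, y = qpi x.
Proof. by exists (repr (y : Quotient.quot I)); rewrite /qpi reprK. Qed.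

Lemma qpi_eq x y : (qpi x == qpi y) = (x - y \in I).
Proof. by rewrite Quotient.idealrBE. Qed.

Lemma qpiB : {morph qpi : x y / x - y}.
Proof. exact: raddfB. Qed.

Definition qmul (x y : Q) : Q :=
  qpi (repr (x : Quotient.quot I) * repr (y : Quotient.quot I)).

Lemma qmulE x y : qmul (qpi x) (qpi y) = qpi (x * y).
Proof.
have E z : repr (qpi z : Quotient.quot I) - z \in I.
  by rewrite -qpi_eq /qpi reprK.
apply/eqP; rewrite /qmul qpi_eq.
set x' := repr _; set y' := repr _.
have -> : x' * y' - x * y = (x' - x) * y' + x * (y' - y).
  by rewrite mulrBl mulrBr addrA subrK.
by apply: rpredD; [apply: ideal2Mr|apply: ideal2Ml]; apply: E.
Qed.

Fact qmulA : associative qmul.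
Proof.
move=> x y z; have [[a ->] [b ->] [c ->]] := And3 (qpi_surj x) (qpi_surj y) (qpi_surj z).
by rewrite !qmulE mulrA.
Qed.
Fact qmul1 : left_id (qpi 1) qmul.
Proof. by move=> x; have [a ->] := qpi_surj x; rewrite qmulE mul1r. Qed.
Fact qmulr1 : right_id (qpi 1) qmul.
Proof. by move=> x; have [a ->] := qpi_surj x; rewrite qmulE mulr1. Qed.
Lemma qpiD : {morph qpi : x y / x + y}.
Proof. exact: raddfD. Qed.
Fact qmulDl : left_distributive qmul +%R.
Proof.
move=> x y z; have [[a ->] [b ->] [c ->]] := And3 (qpi_surj x) (qpi_surj y) (qpi_surj z).
by rewrite -qpiD !qmulE mulrDl qpiD.
Qed.
Fact qmulDr : right_distributive qmul +%R.
Proof.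
move=> x y z; have [[a ->] [b ->] [c ->]] := And3 (qpi_surj x) (qpi_surj y) (qpi_surj z).
by rewrite -qpiD !qmulE mulrDr qpiD.
Qed.
HB.instance Definition _ :=
  GRing.Zmodule_isPzRing.Build Q qmulA qmul1 qmulr1 qmulDl qmulDr.

Fact qpi_zmod_morphism : zmod_morphism qpi. Proof. exact: qpiB. Qed.
Fact qpi_monoid_morphism : monoid_morphism qpi.
Proof. by split=> // x y; rewrite -qmulE. Qed.
HB.instance Definition _ := GRing.isZmodMorphism.Build A Q qpi qpi_zmod_morphism.
HB.instance Definition _ := GRing.isMonoidMorphism.Build A Q qpi qpi_monoid_morphism.
End QuotRing.

Section QuotAlg.
Variables (k : fieldType) (A : kalgType k) (I : ideal2 A).
Fact quot_kstrC (c : k) (x : quot_alg I) :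
  (qpi I \o kstr) c * x = x * (qpi I \o kstr) c.
Proof. by have [a ->] := qpi_surj x; rewrite /= -!rmorphM kstrC. Qed.
HB.instance Definition _ := isKAlgebra.Build k (quot_alg I) quot_kstrC.
End QuotAlg.

Definition dprod (J : Type) (V : J -> Type) : Type := forall j, V j.

Section DProd.
Variables (J : Type) (V : J -> zmodType).
Notation P := (dprod V).
HB.instance Definition _ := Choice.copy P (forall j, V j).
Fact dprod_addA : associative (fun f g : P => (fun j => f j + g j) : P).
Proof. by move=> f g h; apply: functional_extensionality_dep => j; rewrite addrA. Qed.
Fact dprod_addC : commutative (fun f g : P => (fun j => f j + g j) : P).
Proof. by move=> f g; apply: functional_extensionality_dep => j; rewrite addrC. Qed.
Fact dprod_add0 : left_id ((fun=> 0) : P) (fun f g : P => (fun j => f j + g j) : P).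
Proof. by move=> f; apply: functional_extensionality_dep => j; rewrite add0r. Qed.
Fact dprod_addN : left_inverse ((fun=> 0) : P) (fun f : P => (fun j => - f j) : P)
  (fun f g : P => (fun j => f j + g j) : P).
Proof. by move=> f; apply: functional_extensionality_dep => j; rewrite addNr. Qed.
HB.instance Definition _ :=
  GRing.isZmodule.Build P dprod_addA dprod_addC dprod_add0 dprod_addN.
End DProd.

(* Countable direct sums, as finitely supported families. *)
Definition finsupp (V : nat -> zmodType) : {pred dprod V} :=
  fun f => `[< exists N, forall n, (N <= n)%N -> f n = 0 >].
Arguments finsupp : clear implicits.

Section FinSupp.
Variable V : nat -> zmodType.
Lemma finsuppP (f : dprod V) :
  reflect (exists N, forall n, (N <= n)%N -> f n = 0) (f \in finsupp V).
Proof. exact: asboolP. Qed.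
Fact finsupp_zmod_closed : zmod_closed (finsupp V).
Proof.
split=> [|f g /finsuppP[a fa] /finsuppP[b gb]]; apply/finsuppP.
  by exists 0%N.
exists (a + b)%N => n len; change (f n - g n = 0).
by rewrite fa ?gb ?subr0 // (leq_trans _ len) ?leq_addr ?leq_addl.
Qed.
HB.instance Definition _ :=
  GRing.isZmodClosed.Build (dprod V) (finsupp V) finsupp_zmod_closed.
End FinSupp.

Record dsum (V : nat -> zmodType) :=
  DSum { dsum_val : dprod V; dsum_valP : dsum_val \in finsupp V }.

Definition dsum_at V (f : dsum V) n : V n := dsum_val f n.
Coercion dsum_at : dsum >-> Funclass.

Section DSum.
Variable V : nat -> zmodType.
HB.instance Definition _ := [isSub for @dsum_val V].
HB.instance Definition _ := [Choice of dsum V by <:].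
HB.instance Definition _ := [SubChoice_isSubZmodule of dsum V by <:].

Definition homog_fun n (x : V n) : dprod V := fun m =>
  if n =P m is ReflectT e then eq_rect n (fun j => V j) x m e else 0.

Lemma homog_funE n (x : V n) : homog_fun x n = x.
Proof. by rewrite /homog_fun; case: eqP => // e; rewrite (eq_axiomK e). Qed.

Lemma homog_fun_neq n m (x : V n) : n != m -> homog_fun x m = 0.
Proof. by rewrite /homog_fun; case: eqP. Qed.

Fact homog_subproof n (x : V n) : homog_fun x \in finsupp V.
Proof.
apply/finsuppP; exists n.+1 => m lt_nm; apply: homog_fun_neq.
by rewrite neq_ltn lt_nm.
Qed.
Definition homog n (x : V n) : dsum V := DSum (homog_subproof x).

Lemma dsumP (f g : dsum V) : (forall n, f n = g n) -> f = g.
Proof. by move=> fg; apply: val_inj; apply: functional_extensionality_dep. Qed.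

Lemma dsumDE (f g : dsum V) n : (f + g) n = f n + g n.
Proof. by []. Qed.

Lemma dsum0E n : (0 : dsum V) n = 0.
Proof. by []. Qed.

Lemma dsum_sumE I r (P : pred I) (F : I -> dsum V) n :
  (\sum_(i <- r | P i) F i) n = \sum_(i <- r | P i) F i n.
Proof. by elim/big_rec2: _ => // i x y _ <-. Qed.

Lemma homogD n : {morph @homog n : x y / x + y}.
Proof.
move=> x y; apply: dsumP => m; rewrite dsumDE /= /homog_fun.
by case: eqP => [e|]; [case: m / e | rewrite addr0].
Qed.

Lemma homog0 n : homog (0 : V n) = 0.
Proof. by apply: (addrI (homog (0 : V n))); rewrite -homogD !addr0. Qed.

Lemma dsumE (f : dsum V) N : (forall n, (N <= n)%N -> f n = 0) ->
  f = \sum_(i < N) homog (f i).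
Proof.
move=> fN; apply: dsumP => n; rewrite dsum_sumE.
case: (ltnP n N) => [lt_nN|le_Nn].
  rewrite (bigD1 (Ordinal lt_nN)) //= homog_funE big1 ?addr0 // => i.
  by rewrite -val_eqE /= => ?; rewrite homog_fun_neq.
rewrite fN // big1 // => i _; rewrite /= homog_fun_neq //.
by rewrite neq_ltn (leq_trans (ltn_ord i)).
Qed.

Lemma dsum_ind (P : dsum V -> Prop) :
  P 0 -> (forall f g, P f -> P g -> P (f + g)) ->
  (forall n (x : V n), P (homog x)) -> forall f, P f.
Proof.
move=> P0 PD Ph f; have /finsuppP[N fN] := dsum_valP f.
by rewrite (dsumE fN); elim/big_ind: _.
Qed.
End DSum.

(* [A]-[B]-bimodules on which [k] acts centrally. *)
Record is_bimodule (k : fieldType) (A B : kalgType k) (M : zmodType)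
    (l : A -> M -> M) (r : M -> B -> M) : Prop := IsBimodule {
  bimod_lDl : forall a b m, l (a + b) m = l a m + l b m;
  bimod_lDr : forall a m n, l a (m + n) = l a m + l a n;
  bimod_l1 : forall m, l 1 m = m;
  bimod_lA : forall a b m, l a (l b m) = l (a * b) m;
  bimod_rDl : forall m n b, r (m + n) b = r m b + r n b;
  bimod_rDr : forall m a b, r m (a + b) = r m a + r m b;
  bimod_r1 : forall m, r m 1 = m;
  bimod_rA : forall m a b, r (r m a) b = r m (a * b);
  bimod_lr : forall a m b, r (l a m) b = l a (r m b);
  bimod_k : forall (c : k) m, l (kstr c) m = r m (kstr c)
}.

Record bimod (k : fieldType) (A B : kalgType k) := Bimod {
  bimod_car :> zmodType;
  lact : A -> bimod_car -> bimod_car;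
  ract : bimod_car -> B -> bimod_car;
  bimodP : is_bimodule lact ract
}.

Section Regular.
Variables (k : fieldType) (D : kalgType k).
Fact regular_bimodP : is_bimodule (@GRing.mul D) (@GRing.mul D).
Proof.
split; try by move=> *; rewrite ?mulrDl ?mulrDr ?mul1r ?mulr1 ?mulrA ?kstrC.
Qed.
Definition regular_bimod : bimod D D := Bimod regular_bimodP.
End Regular.

(* The tensor product N (x)_D P: the free abelian group on N x P modulo the
   subgroup generated by the biadditivity and balancing relations. *)
Section Tensor.
Variables (k : fieldType) (A D B : kalgType k) (N : bimod A D) (P : bimod D B).

Definition tensor_rel (g : {freeg (N * P)}) : Prop :=
  [\/ exists (n n' : N) (p : P), g = << (n + n', p) >> - << (n, p) >> - << (n', p) >>,
      exists (n : N) (p p' : P), g = << (n, p + p') >> - << (n, p) >> - << (n, p') >>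
    | exists (n : N) (d : D) (p : P), g = << (ract n d, p) >> - << (n, lact d p) >>].

Definition tensor : Type := Quotient.quot (zspan tensor_rel).
HB.instance Definition _ := GRing.Zmodule.on tensor.

Definition tpi (g : {freeg (N * P)}) : tensor := \pi_(Quotient.quot (zspan tensor_rel)) g.
Definition tens (n : N) (p : P) : tensor := tpi << (n, p) >>.

Lemma tpiB : {morph tpi : x y / x - y}. Proof. exact: raddfB. Qed.
Lemma tpiD : {morph tpi : x y / x + y}. Proof. exact: raddfD. Qed.
Lemma tpi0 : tpi 0 = 0. Proof. exact: raddf0. Qed.
Lemma tpiN : {morph tpi : x / - x}. Proof. exact: raddfN. Qed.
Lemma tpi_eq0 g : (tpi g == 0) = (g \in zspan tensor_rel).
Proof. by rewrite -tpi0 -[g in RHS]subr0 Quotient.idealrBE. Qed.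
Lemma tpi_surj (t : tensor) : exists g, t = tpi g.
Proof. by exists (repr (t : Quotient.quot _)); rewrite /tpi reprK. Qed.

Lemma tensDl n n' p : tens (n + n') p = tens n p + tens n' p.
Proof.
apply/eqP; rewrite -subr_eq0 opprD addrA -!tpiB tpi_eq0.
by apply: zspan_gen; apply: Or31; exists n, n', p.
Qed.
Lemma tensDr n p p' : tens n (p + p') = tens n p + tens n p'.
Proof.
apply/eqP; rewrite -subr_eq0 opprD addrA -!tpiB tpi_eq0.
by apply: zspan_gen; apply: Or32; exists n, p, p'.
Qed.
Lemma tensA n d p : tens (ract n d) p = tens n (lact d p).
Proof.
apply/eqP; rewrite -subr_eq0 -!tpiB tpi_eq0.
by apply: zspan_gen; apply: Or33; exists n, d, p.
Qed.

Lemma tens0l p : tens 0 p = 0.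
Proof. by apply: (addrI (tens 0 p)); rewrite -tensDl !addr0. Qed.

Lemma tensNl n p : tens (- n) p = - tens n p.
Proof. by apply: (addrI (tens n p)); rewrite -tensDl !subrr tens0l. Qed.

Lemma tensor_ind (Q : tensor -> Prop) :
  (forall n p, Q (tens n p)) -> (forall s t, Q s -> Q t -> Q (s + t)) ->
  forall t, Q t.
Proof.
move=> Qt QD t; have Q0 : Q 0 by rewrite -(tens0l 0).
have [g ->] := tpi_surj t; elim/freeg_ind_dom0: g => [|c [n p] g _ _ Qg].
  by rewrite tpi0.
rewrite tpiD; apply: (QD) => //.
have -> : << c *g (n, p) >> = << (n, p) >> *~ c :> {freeg (N * P)}.
  by rewrite freegU_mulz intz.
have QM m x y : Q (tpi (<< (x, y) >> *+ m)).
  elim: m => [|m IHm]; first by rewrite mulr0n tpi0.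
  by rewrite mulrS tpiD; exact: (QD _ _ (Qt x y) IHm).
case: c => m; first exact: QM.
rewrite NegzE mulrNz tpiN.
suff -> : - tpi (<< (n, p) >> *+ m.+1) = tpi (<< (- n, p) >> *+ m.+1) by [].
elim: (m.+1) => [|j IHj]; first by rewrite !mulr0n tpi0 oppr0.
by rewrite !mulrS !tpiD opprD IHj -tensNl.
Qed.

(* The map out of the tensor product induced by [f], meaningful when [f] is
   biadditive and balanced. *)
Definition tlift (V : zmodType) (f : N -> P -> V) (t : tensor) : V :=
  fglift (fun x => f x.1 x.2 : zmodule V) (repr (t : Quotient.quot (zspan tensor_rel))).

Definition balanced (V : zmodType) (f : N -> P -> V) : Prop :=
  [/\ forall n n' p, f (n + n') p = f n p + f n' p,
      forall n p p', f n (p + p') = f n p + f n p'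
    & forall n d p, f (ract n d) p = f n (lact d p)].

Section Lift.
Variables (V : zmodType) (f : N -> P -> V).
Hypothesis f_bal : balanced f.
Local Notation F := (fglift (fun x => f x.1 x.2 : zmodule V)).

Fact fgliftB : {morph F : g h / g - h}.
Proof. exact: lift_is_additive. Qed.
Fact fgliftU n p : F << (n, p) >> = f n p.
Proof. by rewrite liftU scale1r. Qed.

Fact flift_ker_zmod_closed : zmod_closed [pred g | F g == 0].
Proof.
have F0 : F 0 = 0 by rewrite -(subrr 0) fgliftB subrr.
split=> [|g h]; rewrite !inE; first by rewrite F0.
by rewrite fgliftB => /eqP-> /eqP->; rewrite subr0.
Qed.

Lemma tlift_tpi g : tlift f (tpi g) = F g.
Proof.
apply/eqP; rewrite -subr_eq0 -fgliftB.
have : repr (tpi g : Quotient.quot (zspan tensor_rel)) - g \in zspan tensor_rel.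
  by rewrite Quotient.idealrBE reprK.
move/zspanP => /(_ _ flift_ker_zmod_closed); apply => {}g; case: f_bal => fDl fDr fA.
case=> [[n [n' [p ->]]]|[n [p [p' ->]]]|[n [d [p ->]]]];
  by rewrite inE !fgliftB !fgliftU ?fDl ?fDr ?fA ?addrK ?subrr // addrAC addrK subrr.
Qed.

Lemma tlift_tens n p : tlift f (tens n p) = f n p.
Proof. by rewrite tlift_tpi fgliftU. Qed.

Lemma tliftD : {morph tlift f : s t / s + t}.
Proof.
move=> s t; have [[g ->] [h ->]] := conj (tpi_surj s) (tpi_surj t).
have F0 : F 0 = 0 by rewrite -(subrr 0) fgliftB subrr.
have FN x : F (- x) = - F x by rewrite -[- x]sub0r fgliftB F0 sub0r.
by rewrite -tpiD !tlift_tpi -{1}[h]opprK fgliftB FN opprK.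
Qed.
End Lift.

Definition tlact (a : A) (t : tensor) : tensor := tlift (fun n p => tens (lact a n) p) t.
Definition tract (t : tensor) (b : B) : tensor := tlift (fun n p => tens n (ract p b)) t.

Fact tlact_bal a : balanced (fun n p => tens (lact a n) p).
Proof.
split=> [n n' p|n p p'|n d p]; last by rewrite -(bimod_lr (bimodP N)) tensA.
  by rewrite (bimod_lDr (bimodP N)) tensDl.
by rewrite tensDr.
Qed.
Fact tract_bal b : balanced (fun n p => tens n (ract p b)).
Proof.
split=> [n n' p|n p p'|n d p]; first by rewrite tensDl.
  by rewrite (bimod_rDl (bimodP P)) tensDr.
by rewrite tensA (bimod_lr (bimodP P)).
Qed.

Lemma tlactE a n p : tlact a (tens n p) = tens (lact a n) p.
Proof. exact/tlift_tens/tlact_bal. Qed.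
Lemma tractE b n p : tract (tens n p) b = tens n (ract p b).
Proof. exact/(tlift_tens (tract_bal b)). Qed.
Lemma tlactD a s t : tlact a (s + t) = tlact a s + tlact a t.
Proof. exact/tliftD/tlact_bal. Qed.
Lemma tractD b s t : tract (s + t) b = tract s b + tract t b.
Proof. exact/(tliftD (tract_bal b)). Qed.

Fact tensor_bimodP : is_bimodule tlact tract.
Proof.
have [lDl lDr l1 lA _ _ _ _ Nlr Nk] := bimodP N.
have [_ _ _ _ rDl rDr r1 rA Plr Pk] := bimodP P.
split.
- move=> a b; elim/tensor_ind => [n p|s t]; first by rewrite !tlactE lDl tensDl.
  by rewrite !tlactD => -> ->; rewrite addrACA.
- exact: tlactD.
- elim/tensor_ind => [n p|s t]; first by rewrite !tlactE l1.
  by rewrite !tlactD => -> ->.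
- move=> a b; elim/tensor_ind => [n p|s t]; first by rewrite !tlactE lA.
  by rewrite !tlactD => -> ->.
- by move=> s t b; apply: tractD.
- elim/tensor_ind => [n p|s t Hs Ht] a b; first by rewrite !tractE rDr tensDr.
  by rewrite !tractD Hs Ht addrACA.
- elim/tensor_ind => [n p|s t]; first by rewrite !tractE r1.
  by rewrite !tractD => -> ->.
- elim/tensor_ind => [n p|s t Hs Ht] a b; first by rewrite !tractE rA.
  by rewrite !tractD Hs Ht.
- move=> a; elim/tensor_ind => [n p|s t Hs Ht] b.
    by rewrite !(tlactE, tractE).
  by rewrite !(tlactD, tractD) Hs Ht.
- move=> c; elim/tensor_ind => [n p|s t Hs Ht].
    by rewrite tlactE tractE Nk tensA Pk.
  by rewrite !(tlactD, tractD) Hs Ht.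
Qed.
Definition tensor_bimod : bimod A B := Bimod tensor_bimodP.
End Tensor.

(* [tpow M n] is M (x)_D (M (x)_D ( ... (x)_D D)), with n factors M; the final
   factor D is the value for n = 0 and is neutral for (x)_D otherwise.  The
   product on [talg] concatenates tensors. *)
Section TensorAlgebra.
Variables (k : fieldType) (D : kalgType k) (M : bimod D D).

Fixpoint tpow (n : nat) : bimod D D :=
  if n is n'.+1 then tensor_bimod M (tpow n') else regular_bimod D.

Fixpoint tmul (m n : nat) : tpow m -> tpow n -> tpow (m + n) :=
  match m with
  | 0 => fun d z => lact d z
  | m'.+1 => fun t z => tlift (fun x y => tens x (@tmul m' n y z)) t
  end.

Fact tmul_lin m n :
  (forall s t z, @tmul m n (s + t) z = tmul s z + tmul t z) /\
  (forall d t z, @tmul m n (lact d t) z = lact d (tmul t z)).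
Proof.
elim: m => [|m [IHD IHl]] /=.
  by split=> *; rewrite /= ?(bimod_lDl (bimodP _)) ?(bimod_lA (bimodP _)).
have bal z : balanced (fun (x : M) y => tens x (@tmul m n y z)).
  split=> [x x' y|x y y'|x d y]; first by rewrite tensDl.
    by rewrite IHD tensDr.
  by rewrite IHl tensA.
split=> [s t z|d t z]; first by rewrite (tliftD (bal z)).
elim/tensor_ind: t => [x y|s t Hs Ht].
  by rewrite tlactE !(tlift_tens (bal z)) tlactE.
by rewrite tlactD !(tliftD (bal z)) tlactD Hs Ht.
Qed.

Lemma tmulDl m n s t z : @tmul m n (s + t) z = tmul s z + tmul t z.
Proof. by case: (tmul_lin m n). Qed.
Lemma tmul_lact m n d t z : @tmul m n (lact d t) z = lact d (tmul t z).
Proof. by case: (tmul_lin m n). Qed.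

Lemma tmul_bal m n (z : tpow n) : balanced (fun (x : M) y => tens x (@tmul m n y z)).
Proof.
split=> [x x' y|x y y'|x d y]; first by rewrite tensDl.
  by rewrite tmulDl tensDr.
by rewrite tmul_lact tensA.
Qed.

Lemma tmulSE m n x (y : tpow m) (z : tpow n) :
  tmul (tens x y : tpow m.+1) z = tens x (tmul y z) :> tpow (m.+1 + n).
Proof. exact: (tlift_tens (tmul_bal m z)). Qed.

Lemma tmulDr m n s y z : @tmul m n s (y + z) = tmul s y + tmul s z.
Proof.
elim: m s => [|m IHm] s; first exact: (bimod_lDr (bimodP _)).
elim/tensor_ind: s => [x t|s t Hs Ht].
  by rewrite !tmulSE IHm tensDr.
by rewrite !tmulDl Hs Ht addrACA.
Qed.

Lemma tmul0l m n z : @tmul m n 0 z = 0.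
Proof. by apply: (addrI (tmul 0 z)); rewrite -tmulDl !addr0. Qed.
Lemma tmul0r m n s : @tmul m n s 0 = 0.
Proof. by apply: (addrI (tmul s 0)); rewrite -tmulDr !addr0. Qed.

Definition talg : Type := dsum tpow.
HB.instance Definition _ := GRing.Zmodule.on talg.

Definition thomog n (x : tpow n) : talg := homog x.

Lemma thomogD n : {morph @thomog n : x y / x + y}.
Proof. exact: homogD. Qed.
Lemma thomog0 n : thomog (0 : tpow n) = 0.
Proof. exact: homog0. Qed.

Definition tconv (f g : talg) : dprod tpow := fun n =>
  \sum_(i < n.+1) \sum_(j < n.+1) thomog (tmul (f i) (g j)) n.

Fact tconv_subproof f g : tconv f g \in finsupp tpow.
Proof.
have [/finsuppP[a fa] /finsuppP[b gb]] := conj (dsum_valP f) (dsum_valP g).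
apply/finsuppP; exists (a + b)%N => n len.
rewrite /tconv big1 // => i _; rewrite big1 // => j _.
have [Eij|neq] := eqVneq (i + j)%N n; last exact: homog_fun_neq.
have [ai|ia] := leqP a i; first by rewrite [f i]fa // tmul0l thomog0.
have bj : (b <= j)%N by rewrite -(leq_add2l i) Eij (leq_trans _ len) // leq_add2r ltnW.
by rewrite [g j]gb // tmul0r thomog0.
Qed.
Definition tmulr (f g : talg) : talg := DSum (tconv_subproof f g).

Lemma tmulrE f g n :
  tmulr f g n = \sum_(i < n.+1) \sum_(j < n.+1) thomog (tmul (f i) (g j)) n.
Proof. by []. Qed.
Lemma thomogE n (x : tpow n) : thomog x n = x.
Proof. exact: homog_funE. Qed.
Lemma thomog_neq n m (x : tpow n) : n != m -> thomog x m = 0.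
Proof. exact: homog_fun_neq. Qed.

Lemma tmulrDl : left_distributive tmulr +%R.
Proof.
move=> f g h; apply: dsumP => n; rewrite dsumDE /= -big_split.
by apply: eq_bigr => i _; rewrite -big_split; apply: eq_bigr => j _;
   rewrite dsumDE tmulDl thomogD.
Qed.
Lemma tmulrDr : right_distributive tmulr +%R.
Proof.
move=> f g h; apply: dsumP => n; rewrite dsumDE /= -big_split.
by apply: eq_bigr => i _; rewrite -big_split; apply: eq_bigr => j _;
   rewrite dsumDE tmulDr thomogD.
Qed.

Lemma tmulr_homog m n (x : tpow m) (y : tpow n) :
  tmulr (thomog x) (thomog y) = thomog (tmul x y).
Proof.
apply: dsumP => p; rewrite tmulrE.
have [Ep|neq] := eqVneq (m + n)%N p; last first.
  rewrite [RHS]thomog_neq // big1 // => i _; rewrite big1 // => j _.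
  have [Ei|ni] := eqVneq m i; last by rewrite [thomog x i]thomog_neq ?tmul0l ?thomog0.
  have [Ej|nj] := eqVneq n j; last by rewrite [thomog y j]thomog_neq ?tmul0r ?thomog0.
  by apply: thomog_neq; rewrite -Ei -Ej.
have lm : (m < p.+1)%N by rewrite ltnS -Ep leq_addr.
have ln : (n < p.+1)%N by rewrite ltnS -Ep leq_addl.
rewrite (bigD1 (Ordinal lm)) // [X in _ + X = _]big1 => [|i]; last first.
  rewrite -val_eqE eq_sym => ni; rewrite big1 // => j _.
  by rewrite [thomog x i]thomog_neq // tmul0l thomog0.
rewrite (bigD1 (Ordinal ln)) // [X in _ + X + _]big1 => [|j]; last first.
  rewrite -val_eqE eq_sym => nj.
  by rewrite [thomog y j]thomog_neq // tmul0r thomog0.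
by rewrite !addr0 !thomogE.
Qed.

Lemma tmulr0 f : tmulr f 0 = 0.
Proof. by apply: (addrI (tmulr f 0)); rewrite -tmulrDr !addr0. Qed.
Lemma tmul0r' f : tmulr 0 f = 0.
Proof. by apply: (addrI (tmulr 0 f)); rewrite -tmulrDl !addr0. Qed.

Definition tunit : tpow 0 := (1 : D).
Definition tdeg1 (x : M) : talg := @thomog 1 (tens x tunit).

Lemma thomog_tens_ind m (Q : talg -> Prop) :
  (forall x (y : tpow m), Q (@thomog m.+1 (tens x y))) ->
  (forall s t, Q s -> Q t -> Q (s + t)) -> forall t : tpow m.+1, Q (thomog t).
Proof.
move=> Qt QD t; elim/tensor_ind: t => [x y|s t Qs Qt']; first exact: Qt.
rewrite [X in Q X](@thomogD m.+1); exact: QD.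
Qed.

Lemma tmulr_tens m x (y : tpow m) :
  @thomog m.+1 (tens x y) =
  tmulr (tdeg1 x) (thomog y).
Proof. by rewrite tmulr_homog (@tmulSE 0) /= (bimod_l1 (bimodP _)). Qed.

Fact tmulrA_aux m n p (x : tpow m) (y : tpow n) (z : tpow p) :
  tmulr (thomog x) (tmulr (thomog y) (thomog z)) =
  tmulr (tmulr (thomog x) (thomog y)) (thomog z).
Proof.
elim: m x => [|m IHm] x.
  by rewrite !tmulr_homog; exact: (congr1 (@thomog (n + p)) (esym (tmul_lact x y z))).
pose Q t := tmulr t (tmulr (thomog y) (thomog z)) =
  tmulr (tmulr t (thomog y)) (thomog z).
apply: (@thomog_tens_ind m Q) => [{}x t|s t]; last first.
  by rewrite /Q !tmulrDl => -> ->.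
have E q (b : tpow q) r (c : tpow r) :
  tmulr (tdeg1 x) (tmulr (thomog b) (thomog c)) =
  tmulr (tmulr (tdeg1 x) (thomog b)) (thomog c).
  rewrite -[tmulr _ (thomog b)]tmulr_tens tmulr_homog.
  by rewrite -[LHS]tmulr_tens [RHS](@tmulr_homog q.+1) (@tmulSE q).
rewrite /Q tmulr_tens (tmulr_homog y z) -(E m t (n + p)%N (tmul y z)).
rewrite -(tmulr_homog y z) IHm (tmulr_homog t y).
by rewrite (E (m + n)%N (tmul t y) p z) -(tmulr_homog t y) (E m t n y).
Qed.

Fact tmulrA : associative tmulr.
Proof.
elim/dsum_ind => [|f f' Hf Hf'|m x] g h; first by rewrite !tmul0r'.
  by rewrite !tmulrDl Hf Hf'.
elim/dsum_ind: g h => [|g g' Hg Hg'|n y] h; first by rewrite tmul0r' !tmulr0 tmul0r'.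
  by rewrite !(tmulrDl, tmulrDr) Hg Hg'.
elim/dsum_ind: h => [|h h' Hh Hh'|p z]; first by rewrite !tmulr0.
  by rewrite !tmulrDr Hh Hh'.
exact: tmulrA_aux.
Qed.

Definition tone : talg := thomog tunit.

Fact tmul1r : left_id tone tmulr.
Proof.
elim/dsum_ind => [|f f' Hf Hf'|m x]; first by rewrite tmulr0.
  by rewrite tmulrDr Hf Hf'.
by rewrite tmulr_homog /= (bimod_l1 (bimodP _)).
Qed.

Fact tmulr1 : right_id tone tmulr.
Proof.
elim/dsum_ind => [|f f' Hf Hf'|m x]; first by rewrite tmul0r'.
  by rewrite tmulrDl Hf Hf'.
elim: m x => [|m IHm] x.
  by rewrite tmulr_homog /= /lact /= mulr1.
apply: (@thomog_tens_ind m (fun t => tmulr t tone = t)) => [{}x t|s t].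
  by rewrite tmulr_tens -tmulrA IHm.
by rewrite !tmulrDl => -> ->.
Qed.

HB.instance Definition _ :=
  GRing.Zmodule_isPzRing.Build talg tmulrA tmul1r tmulr1 tmulrDl tmulrDr.

Definition tdeg0 (d : D) : talg := @thomog 0 d.

Fact tdeg0_zmod_morphism : zmod_morphism tdeg0.
Proof.
move=> x y; apply: (addIr (tdeg0 y)); rewrite subrK /tdeg0.
by rewrite -(@thomogD 0) subrK.
Qed.
Fact tdeg0_monoid_morphism : monoid_morphism tdeg0.
Proof. by split=> // x y; rewrite [RHS]tmulr_homog. Qed.
HB.instance Definition _ := GRing.isZmodMorphism.Build D talg tdeg0 tdeg0_zmod_morphism.
HB.instance Definition _ := GRing.isMonoidMorphism.Build D talg tdeg0 tdeg0_monoid_morphism.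

Fact talg_kstrC (c : k) (f : talg) : (tdeg0 \o kstr) c * f = f * (tdeg0 \o kstr) c.
Proof.
elim/dsum_ind: f => [|f f' Hf Hf'|m x]; first by rewrite mulr0 mul0r.
  by rewrite mulrDl mulrDr Hf Hf'.
rewrite /=; elim: m x => [|m IHm] x.
  have := congr1 tdeg0 (kstrC c (x : D)); rewrite !rmorphM; exact.
apply: (@thomog_tens_ind m (fun t => tdeg0 (kstr c) * t = t * tdeg0 (kstr c))) => [{}x t|s t].
  have -> : @thomog m.+1 (tens x t) = tdeg1 x * thomog t by exact: tmulr_tens.
  rewrite -mulrA -IHm !mulrA; congr (_ * _).
  rewrite [LHS]tmulr_homog [RHS]tmulr_homog (@tmulSE 0) /=.
  rewrite tlactE (bimod_k (bimodP M)) tensA; congr (@thomog 1 (tens x _)).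
  exact: (etrans (mulr1 _) (esym (mul1r _))).
by rewrite mulrDl mulrDr => -> ->.
Qed.
HB.instance Definition _ := isKAlgebra.Build k talg talg_kstrC.
End TensorAlgebra.

(* [sbim j i] is the D_j-D_i-bimodule written {}_jM_i. *)
Record species (k : fieldType) := Species {
  vert : finType;
  sdiv : vert -> falgType k;
  sdivP : forall i (x : sdiv i), x != 0 -> x \is a GRing.unit;
  sbim : vert -> vert -> vectType k;
  slact : forall j i, sdiv j -> sbim j i -> sbim j i;
  sract : forall j i, sbim j i -> sdiv i -> sbim j i;
  sbimP : forall j i, is_bimodule (@slact j i) (@sract j i);
  sbim_scale : forall j i (c : k) (m : sbim j i), slact c%:A m = c *: m
}.
Arguments sdiv {k} s _.
Arguments sbim {k} s _ _.

Section SpeciesTensorAlgebra.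
Variables (k : fieldType) (S : species k).

Definition sring : Type := dprod (fun i : vert S => sdiv S i).
HB.instance Definition _ :=
  GRing.Zmodule.copy sring (dprod (fun i : vert S => sdiv S i : zmodType)).
Local Notation funE := functional_extensionality_dep.

Definition sring_one : sring := fun i => 1.
Definition sring_mul (a b : sring) : sring := fun i => a i * b i.
Fact sring_mulA : associative sring_mul.
Proof. by move=> a b c; apply: funE => i; apply: mulrA. Qed.
Fact sring_mul1 : left_id sring_one sring_mul.
Proof. by move=> a; apply: funE => i; apply: mul1r. Qed.
Fact sring_mulr1 : right_id sring_one sring_mul.
Proof. by move=> a; apply: funE => i; apply: mulr1. Qed.
Fact sring_mulDl : left_distributive sring_mul +%R.
Proof. by move=> a b c; apply: funE => i; apply: mulrDl. Qed.
Fact sring_mulDr : right_distributive sring_mul +%R.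
Proof. by move=> a b c; apply: funE => i; apply: mulrDr. Qed.
HB.instance Definition _ := GRing.Zmodule_isPzRing.Build sring
  sring_mulA sring_mul1 sring_mulr1 sring_mulDl sring_mulDr.

Definition sring_kstr (c : k) : sring := fun i => c%:A.
Fact sring_kstr_zmod_morphism : zmod_morphism sring_kstr.
Proof. by move=> c d; apply: funE => i; apply: scalerBl. Qed.
Fact sring_kstr_monoid_morphism : monoid_morphism sring_kstr.
Proof.
split=> [|c d]; apply: funE => i; first exact: scale1r.
by rewrite /sring_kstr -scalerA -[in LHS](mul1r (d%:A)) scalerAl.
Qed.
HB.instance Definition _ :=
  GRing.isZmodMorphism.Build k sring sring_kstr sring_kstr_zmod_morphism.
HB.instance Definition _ :=
  GRing.isMonoidMorphism.Build k sring sring_kstr sring_kstr_monoid_morphism.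
Fact sring_kstrC (c : k) (a : sring) : sring_kstr c * a = a * sring_kstr c.
Proof. by apply: funE => i; apply: (kstrC c (a i : sdiv S i)). Qed.
HB.instance Definition _ := isKAlgebra.Build k sring sring_kstrC.

(* The element of the product supported at the vertex [i]. *)
Definition sring_inj (i : vert S) (d : sdiv S i) : sring := fun j =>
  if i =P j is ReflectT e then eq_rect i (fun j => sdiv S j) d j e else 0.

Definition smod : Type := dprod (fun p : vert S * vert S => sbim S p.1 p.2).
HB.instance Definition _ := GRing.Zmodule.copy smod
  (dprod (fun p : vert S * vert S => sbim S p.1 p.2 : zmodType)).

Definition smod_lact (a : sring) (m : smod) : smod := fun p => slact (a p.1) (m p).
Definition smod_ract (m : smod) (a : sring) : smod := fun p => sract (m p) (a p.2).
Fact smod_bimodP : is_bimodule smod_lact smod_ract.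
Proof.
split=> *; apply: funE => p;
  have [lDl lDr l1 lA rDl rDr r1 rA lr lk] := sbimP (p.1) (p.2);
  rewrite /smod_lact /smod_ract.
- exact: lDl.
- exact: lDr.
- exact: l1.
- exact: lA.
- exact: rDl.
- exact: rDr.
- exact: r1.
- exact: rA.
- exact: lr.
- exact: lk.
Qed.
Definition smod_bimod : bimod sring sring := Bimod smod_bimodP.

Definition smod_inj (j i : vert S) (m : sbim S j i) : smod := fun p =>
  if (j, i) =P p is ReflectT e then
    eq_rect (j, i) (fun p => sbim S p.1 p.2) m p e else 0.

Definition tensor_alg : Type := talg smod_bimod.
HB.instance Definition _ := KAlgebra.on tensor_alg.

Definition arrow (i j : vert S) : bool := \dim {:sbim S j i} != 0%N.

Definition no_oriented_cycle : Prop :=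
  forall c : seq (vert S), cycle arrow c -> c = [::].

(* Forgetting orientations may create loops and double edges; both are cycles
   of the underlying graph and are excluded by the first condition. *)
Definition is_tree : Prop :=
  (forall i j, arrow i j -> ~~ arrow j i) /\
  (forall c : seq (vert S), (2 < size c)%N -> uniq c ->
     ~~ cycle (fun i j => arrow i j || arrow j i) c).

(* Elementary tensors g_n (x) ... (x) g_1 along a path of length n >= 1 of the
   quiver from [a] to the index; [EtComp] adds the leftmost factor. *)
Inductive etensor (a : vert S) : vert S -> Type :=
| EtArrow b : arrow a b -> sbim S b a -> etensor a b
| EtComp c b : arrow c b -> sbim S b c -> etensor a c -> etensor a b.

Definition arrow_elt (j i : vert S) (m : sbim S j i) : tensor_alg :=
  tdeg1 (M := smod_bimod) (smod_inj m).

Fixpoint et_eval (a b : vert S) (g : etensor a b) : tensor_alg :=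
  match g with
  | EtArrow _ _ m => arrow_elt m
  | EtComp _ _ _ m g' => arrow_elt m * et_eval g'
  end.

Record relation := Relation {
  rel_src : vert S;
  rel_tgt : vert S;
  rel_summands : seq (etensor rel_src rel_tgt)
}.

Definition rel_terms (s : relation) : seq tensor_alg :=
  map (@et_eval (rel_src s) (rel_tgt s)) (rel_summands s).

Definition rel_elt (s : relation) : tensor_alg := \sum_(g <- rel_terms s) g.

Definition in_sbim (j i : vert S) (x : tensor_alg) : Prop :=
  exists m : sbim S j i, x = arrow_elt m.

(* The [l]-th summand is the only one lying in {}_jM_i. *)
Definition lead_summand (s : relation) (l : nat) : Prop :=
  [/\ (l < size (rel_terms s))%N,
      in_sbim (rel_tgt s) (rel_src s) (nth 0 (rel_terms s) l)
    & forall l', (l' < size (rel_terms s))%N -> l' != l ->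
        ~ in_sbim (rel_tgt s) (rel_src s) (nth 0 (rel_terms s) l')].

Definition canonical_relation (s : relation) : Prop :=
  exists l, lead_summand s l.

Definition strong_canonical_relation (s : relation) : Prop :=
  canonical_relation s /\ (1 < size (rel_terms s))%N.

(* A set of relations is given as a family indexed by an arbitrary type. *)
Definition strong_canonical_set (T : Type) (sigma : T -> relation) : Prop :=
  (forall t, strong_canonical_relation (sigma t)) /\
  (forall t t' l l', t <> t' ->
     rel_src (sigma t) = rel_src (sigma t') ->
     rel_tgt (sigma t) = rel_tgt (sigma t') ->
     lead_summand (sigma t) l -> lead_summand (sigma t') l' ->
     forall x : tensor_alg,
       x \in ideal_gen (eq (nth 0 (rel_terms (sigma t)) l)) ->
       x \in ideal_gen (eq (nth 0 (rel_terms (sigma t')) l')) -> x = 0).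

Definition rel_ideal (T : Type) (sigma : T -> relation) : ideal2 tensor_alg :=
  ideal_gen (fun x => exists t, x = rel_elt (sigma t)).

End SpeciesTensorAlgebra.

Section Modules.
Variable R : pzRingType.

Record submod (V : lmodType R) (W : submodClosed V) :=
  Submod { submod_val : V; _ : submod_val \in W }.

Section SubmodInstances.
Variables (V : lmodType R) (W : submodClosed V).
HB.instance Definition _ := [isSub for @submod_val V W].
HB.instance Definition _ := [Choice of submod W by <:].
HB.instance Definition _ := [SubChoice_isSubLmodule of submod W by <:].
End SubmodInstances.

Definition projective (P : lmodType R) : Prop :=
  forall (N N' : lmodType R) (g : {linear N -> N'}) (f : {linear P -> N'}),
    (forall y, exists x, g x = y) ->
    exists h : {linear P -> N}, forall x, g (h x) = f x.

Definition mod_iso (P Q : lmodType R) : Prop :=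
  exists f : {linear P -> Q}, bijective f.

(* The submodules [W i], for [i : J], have direct sum the whole of [V]. *)
Definition is_direct_sum (V : lmodType R) (J : finType) (W : J -> submodClosed V) :=
  forall x : V, exists! c : {ffun J -> V},
    (forall i, c i \in W i) /\ x = \sum_i c i.

Definition indecomposable (P : lmodType R) : Prop :=
  (exists x : P, x != 0) /\
  (forall W : bool -> submodClosed P, is_direct_sum W ->
     exists b, forall x, x \in W b -> x = 0).

Definition hereditary : Prop :=
  forall J : submodClosed R^o, projective (submod J).

Definition basic : Prop :=
  exists (n : nat) (P : 'I_n -> submodClosed R^o),
    [/\ is_direct_sum P,
        forall i, indecomposable (submod (P i)),
        forall i, projective (submod (P i))
      & forall i j, i != j -> ~ mod_iso (submod (P i)) (submod (P j))].

Definition maximal_left_ideal (J : {pred R^o}) : Prop :=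
  [/\ submod_closed J, 1 \notin J
    & forall J' : {pred R^o}, submod_closed J' -> 1 \notin J' ->
        {subset J <= J'} -> {subset J' <= J}].

Definition jacobson : {pred R} :=
  fun x => `[< forall J, maximal_left_ideal J -> x \in J >].

Lemma jacobsonP x :
  reflect (forall J, maximal_left_ideal J -> x \in J) (x \in jacobson).
Proof. exact: asboolP. Qed.

Fact jacobson_zmod_closed : zmod_closed jacobson.
Proof.
split=> [|x y /jacobsonP Hx /jacobsonP Hy]; apply/jacobsonP => J mJ.
  by case: (mJ) => -[].
have [clJ _ _] := mJ; case: (GRing.submod_closedB clJ) => _; apply; [exact: Hx | exact: Hy].
Qed.

Fact jacobsonMl (a x : R) : x \in jacobson -> a * x \in jacobson.
Proof.
move=> /jacobsonP Hx; apply/jacobsonP => J mJ; have [[J0 Jl] _ _] := mJ.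
by rewrite -[a * x]addr0; apply: (Jl a) => //; apply: Hx.
Qed.

Fact jacobsonMr (a x : R) : x \in jacobson -> x * a \in jacobson.
Proof.
move=> /jacobsonP Hx; apply/jacobsonP => J mJ.
have [[J0 Jl] J1 Jmax] := mJ.
have JM c u : u \in J -> c * u \in J.
  by move=> uJ; rewrite -[c * u]addr0; apply: (Jl c).
have JD u v : u \in J -> v \in J -> u + v \in J.
  by move=> uJ vJ; rewrite -[u]mul1r; apply: (Jl 1).
have [aJ|aJ] := boolP (a \in J); first exact: JM.
pose K : {pred R^o} := fun z => (z : R) * a \in J.
suff mK : maximal_left_ideal K by exact: (Hx K mK).
split; [split|..].
- by rewrite unfold_in /K mul0r.
- move=> c u v uK vK; rewrite unfold_in /K mulrDl; apply: JD => //.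
  by rewrite -mulrA; apply: JM.
- by rewrite unfold_in /K mul1r.
move=> L [L0 Ll] L1 KL z zL; rewrite unfold_in /K; apply/negPn/negP => zaJ.
have LD u v : u \in L -> v \in L -> u + v \in L.
  by move=> uL vL; rewrite -[u]mul1r; apply: (Ll 1).
pose J' : {pred R^o} := fun u => `[< exists j c, j \in J /\ u = j + c * (z * a) >].
have J'1 : 1 \in J'.
  apply/negPn/negP => nJ'1; case/negP: zaJ.
  apply: (Jmax J') => //.
  - split; first by apply/asboolP; exists 0, 0; split; rewrite ?mul0r ?addr0.
    move=> c u v /asboolP[j [d [jJ ->]]] /asboolP[j' [d' [jJ' ->]]].
    apply/asboolP; exists (c * j + j'), (c * d + d'); split; first exact: (Jl c).
    by rewrite [c *: _]mulrDr mulrDl -[c * d * _]mulrA addrACA.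
  - by move=> u uJ; apply/asboolP; exists u, 0; rewrite mul0r addr0.
  - by apply/asboolP; exists 0, 1; rewrite mul1r add0r.
case/asboolP: J'1 => j [c [jJ E1]].
have E : (1 - a * c * z) * a = a * j.
  by rewrite mulrBl mul1r -{1}[a]mulr1 E1 mulrDr -!mulrA addrK.
case/negP: L1; rewrite -[1](subrK (a * c * z)); apply: LD.
  by apply: KL; rewrite unfold_in /K E; apply: JM.
by rewrite -[a * c * z]addr0; apply: (Ll (a * c)).
Qed.
HB.instance Definition _ := GRing.isZmodClosed.Build R jacobson jacobson_zmod_closed.
HB.instance Definition _ := isIdeal2.Build R jacobson jacobsonMl jacobsonMr.
End Modules.
Arguments jacobson : clear implicits.

Section AlgebraNotions.
Variables (k : fieldType) (L : kalgType k).

Definition split_alg : Prop :=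
  exists e : {rmorphism quot_alg (jacobson L) -> L},
    alg_hom e /\ forall x, qpi (jacobson L) (e x) = x.

Definition rad_sq : ideal2 L :=
  ideal_gen (fun z : L => exists x y : L,
    [/\ x \in jacobson L, y \in jacobson L & z = x * y]).

(* The additive span of D_j (r / r^2) D_i inside L / r^2, where D_j and D_i are
   factors of L / r through [theta]. *)
Definition rad_component (S : species k)
    (theta : quot_alg (jacobson L) -> sring S) (j i : vert S) :
    {pred quot_alg rad_sq} :=
  zspan (fun z => exists a x b : L,
    [/\ exists d : sdiv S j, theta (qpi (jacobson L) a) = sring_inj d,
        x \in jacobson L,
        exists d : sdiv S i, theta (qpi (jacobson L) b) = sring_inj d
      & z = qpi rad_sq (a * x * b)]).

(* [S] is the species of [L]: L / r is the product of the D_i, and {}_jM_i is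
   isomorphic to D_j (r / r^2) D_i as a D_j-D_i-bimodule.  The action of an
   element of L / r on r / r^2 is that of any of its representatives in L. *)
Definition is_species_of (S : species k) : Prop :=
  exists theta : {rmorphism quot_alg (jacobson L) -> sring S},
  [/\ alg_hom theta, bijective theta
    & forall j i : vert S, exists f : {additive sbim S j i -> quot_alg rad_sq},
      [/\ injective f,
          forall y, y \in rad_component theta j i <-> exists m, y = f m,
          forall (d : sdiv S j) (a : L) (m : sbim S j i),
            theta (qpi (jacobson L) a) = sring_inj d ->
            f (slact d m) = qpi rad_sq a * f m
        & forall (d : sdiv S i) (b : L) (m : sbim S j i),
            theta (qpi (jacobson L) b) = sring_inj d ->
            f (sract m d) = f m * qpi rad_sq b]].
End AlgebraNotions.

(* Main.v *)
Require Import Defs.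
From HB Require Import structures.
From mathcomp Require Import all_boot all_algebra falgebra.
From mathcomp Require Import boolp.

(* In a tree, a path of length at least 2 from [a] to [b] excludes an arrow
   [a -> b].  Hence the leading summand of a strong canonical relation is zero and
   all its summands have degree at least 2, so the ideal I that they generate lies in J^2,
   where J is the ideal of tensors of positive degree.  As [L = T/I] is
   hereditary, its left ideal J/I is projective, so J/IJ -> J/I splits;
   comparing with J^2 gives I = JI + IJ, and J is nilpotent, so I = 0.

   Thus [T(Sm)] is isomorphic to [L], its radical is J, and [Sm] is a species of
   [L].  A species of [L] determines its tensor algebra, because the ring D and
   the bimodule M are recovered from [L] as L/r and r/r^2. *)

Set Implicit Arguments.
Unset Strict Implicit.
Unset Printing Implicit Defensive.

Import GRing.Theory.
Local Open Scope ring_scope.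
Local Open Scope quotient_scope.

(** * Ideals with hereditary quotient *)

Lemma zspan_sub (V : zmodType) (X : V -> Prop) (H : zmodClosed V) (x : V) :
  (forall y, X y -> y \in H) -> x \in zspan X -> x \in H.
Proof.
move=> XH /zspanP; apply=> //; split; first exact: rpred0.
by move=> *; apply: rpredB.
Qed.

Section HereditaryKernel.
Variables (A B : pzRingType) (p : {rmorphism A -> B}) (J : ideal2 A).
Variables (lift : B -> A) (liftK : cancel lift p).
Hypothesis kerJ : forall x, p x = 0 -> x \in J.

Definition ideal_left : {pred A^o} := fun x => (x : A) \in J.
Fact ideal_left_submod_closed : submod_closed ideal_left.
Proof.
split=> [|a x y xJ yJ]; first exact: (@rpred0 A J).
by apply: (@rpredD A J) => //; apply: ideal2Ml.
Qed.
HB.instance Definition _ :=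
  GRing.isSubmodClosed.Build A A^o ideal_left ideal_left_submod_closed.

(** The image [p(J)], tested through the merely set-theoretic section [lift]; as [J] contains the
    kernel of [p], the choice of preimage does not matter. *)
Definition ideal_image : {pred B^o} := fun b => lift b \in J.

Lemma lift_kerJ a : lift (p a) - a \in J.
Proof. by apply: kerJ; rewrite rmorphB /= liftK subrr. Qed.

Lemma ideal_imageE a : (p a \in ideal_image) = (a \in J).
Proof.
rewrite unfold_in; apply/idP/idP => aJ.
  by rewrite -[a](subKr (lift (p a))) rpredB ?lift_kerJ.
by rewrite -[lift _](subrK a) rpredD ?lift_kerJ.
Qed.

Fact ideal_image_submod_closed : submod_closed ideal_image.
Proof.
split=> [|b x y xJ yJ]; first by rewrite -(rmorph0 p) ideal_imageE rpred0.
rewrite -[x]liftK -[y]liftK -[b]liftK [_ *: _](_ : _ = p (lift b) * p (lift x)) //.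
rewrite -rmorphM -rmorphD ideal_imageE.
by apply: rpredD => //; apply: ideal2Ml.
Qed.
HB.instance Definition _ :=
  GRing.isSubmodClosed.Build B B^o ideal_image ideal_image_submod_closed.

Let Jm : lmodType A := submod ideal_left.
Let Pm : lmodType B := submod ideal_image.

(** With [I] the kernel of [p], these generate the product [IJ] additively. *)
Definition ker_ideal : A -> Prop := fun z =>
  exists x y, [/\ p x = 0, y \in J & z = x * y].

Definition ker_ideal_left : {pred Jm} := fun u => (val u : A) \in zspan ker_ideal.
Fact ker_ideal_left_zmod_closed : zmod_closed ker_ideal_left.
Proof.
split=> [|u v uK vK]; rewrite unfold_in /=; first exact: (rpred0 (zspan ker_ideal)).
exact: (rpredB uK vK).
Qed.
HB.instance Definition _ :=
  GRing.isZmodClosed.Build Jm ker_ideal_left ker_ideal_left_zmod_closed.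

(* [J/IJ], where [I] is the kernel of [p].  The unused argument lets the
   [B]-action on it, defined through [lift], be a canonical structure. *)
Definition ideal_quot (_ : cancel lift p) : Type := Quotient.quot ker_ideal_left.
Local Notation N := (ideal_quot liftK).
HB.instance Definition _ := GRing.Zmodule.on N.

Definition npi (u : Jm) : N := \pi_(Quotient.quot ker_ideal_left) u.
Definition nrepr (n : N) : Jm := repr (n : Quotient.quot ker_ideal_left).
Lemma nreprK : cancel nrepr npi. Proof. by move=> n; rewrite /npi /nrepr reprK. Qed.
Lemma npiB : {morph npi : u v / u - v}. Proof. exact: raddfB. Qed.
Lemma npiD : {morph npi : u v / u + v}. Proof. exact: raddfD. Qed.
Lemma npi0 : npi 0 = 0. Proof. exact: raddf0. Qed.
Lemma npi_eq u v : npi u = npi v <-> (val u : A) - val v \in zspan ker_ideal.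
Proof.
suff -> : npi u = npi v <-> u - v \in ker_ideal_left by [].
by rewrite Quotient.idealrBE; split => /eqP.
Qed.

Definition nscale (b : B) (n : N) : N := npi (lift b *: nrepr n).

(** Changing the representative of the scalar costs an element of [IJ], and so does changing that of
    the vector, because [IJ] is a left ideal. *)
Lemma nscaleE a u : nscale (p a) (npi u) = npi (a *: u).
Proof.
apply/npi_eq => /=.
have -> : lift (p a) * val (nrepr (npi u)) - a * val u =
   (lift (p a) - a) * val (nrepr (npi u)) + a * (val (nrepr (npi u)) - val u) :> A.
  by rewrite mulrBl mulrBr addrA subrK.
apply: rpredD.
  apply: zspan_gen; exists (lift (p a) - a), (val (nrepr (npi u))); split=> //.
    by rewrite rmorphB /= liftK subrr.
  exact: (valP (nrepr _)).
have : val (nrepr (npi u)) - val u \in zspan ker_ideal by apply/npi_eq; rewrite nreprK.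
move: (_ - _) => z.
pose H : {pred A} := fun z => a * z \in zspan ker_ideal.
move/zspanP => /(_ H); apply.
  split=> [|x y xH yH]; rewrite unfold_in ?mulr0 ?rpred0 //.
  by rewrite mulrBr; apply: rpredB.
move=> _ [x [y [px yJ ->]]]; apply: zspan_gen; exists (a * x), y.
by rewrite rmorphM px mulr0 mulrA.
Qed.

Fact nscaleA a b n : nscale a (nscale b n) = nscale (a * b) n.
Proof.
by rewrite -[a]liftK -[b]liftK -[n]nreprK -rmorphM !nscaleE scalerA.
Qed.
Fact nscale1 : left_id 1 nscale.
Proof. by move=> n; rewrite -(rmorph1 p) -[n]nreprK nscaleE scale1r. Qed.
Fact nscaleDr : right_distributive nscale +%R.
Proof.
move=> a m n; rewrite -[a]liftK -[m]nreprK -[n]nreprK -npiD !nscaleE.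
by rewrite scalerDr npiD.
Qed.
Fact nscaleDl n : {morph nscale^~ n : a b / a + b}.
Proof.
move=> a b; rewrite -[a]liftK -[b]liftK -[n]nreprK -rmorphD !nscaleE.
by rewrite scalerDl npiD.
Qed.
HB.instance Definition _ := GRing.Zmodule_isLmodule.Build B N
  nscaleA nscale1 nscaleDr nscaleDl.

Fact jm_image_subproof (u : Jm) : (p (val u) : B^o) \in ideal_image.
Proof. by rewrite ideal_imageE; apply: (valP u). Qed.
Definition jm_image (u : Jm) : Pm := Submod (jm_image_subproof u).

Lemma jm_image_ker u : jm_image u = 0 <-> p (val u) = 0.
Proof. by split=> [/(congr1 val)|pu]; last exact: val_inj. Qed.

Lemma jm_imageD : {morph jm_image : u v / u + v}.
Proof. by move=> u v; apply: val_inj; rewrite /= rmorphD. Qed.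

Lemma jm_imageZ a : {morph jm_image : u / a *: u >-> p a *: u}.
Proof. by move=> u; apply: val_inj; apply: (rmorphM p). Qed.

Lemma jm_imageB : {morph jm_image : u v / u - v}.
Proof. by move=> u v; apply: val_inj; rewrite /= rmorphB. Qed.

Definition nproj (n : N) : Pm := jm_image (nrepr n).
(** [p] kills [IJ], so the map from [J/IJ] to [p(J) = J/I] is independent of the representative. *)
Lemma nprojE u : nproj (npi u) = jm_image u.
Proof.
apply/eqP; rewrite -subr_eq0 -jm_imageB; apply/eqP/jm_image_ker.
have : val (nrepr (npi u)) - val u \in zspan ker_ideal by apply/npi_eq; rewrite nreprK.
rewrite [val (_ - _)](_ : _ = val (nrepr (npi u)) - val u) //; move: (_ - _) => z.
move/zspanP => /(_ (fun z => p z == 0)) H; apply/eqP; apply: H.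
  split=> [|x y]; rewrite !unfold_in ?rmorph0 // rmorphB.
  by move=> /eqP -> /eqP ->; rewrite subr0.
by move=> _ [x [y [px yJ ->]]]; rewrite unfold_in rmorphM px mul0r.
Qed.
Fact nproj_linear : linear nproj.
Proof.
move=> b m n; rewrite -[b]liftK -[m]nreprK -[n]nreprK.
rewrite [_ *: npi _](_ : _ = nscale (p (lift b)) (npi (nrepr m))) //.
by rewrite nscaleE -npiD !nprojE jm_imageD jm_imageZ.
Qed.
HB.instance Definition _ := GRing.isLinear.Build B N Pm _ nproj nproj_linear.

Lemma nproj_surj y : exists x, nproj x = y.
Proof.
have yJ : lift (val y) \in J by apply: (valP y).
exists (npi (@Submod _ A^o ideal_left _ yJ)); rewrite nprojE.
by apply: val_inj; rewrite /= liftK.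
Qed.

(* The section [h] of [J/IJ -> J/I] exhibits [I/IJ] as a direct summand; an
   element of [I/IJ] is a combination of elements of [J] with coefficients in
   [J], so projecting to that summand puts it into [J (I/IJ)]. *)
Lemma hereditary_kernel x : hereditary B -> p x = 0 ->
  x \in zspan (fun z => exists a b, [/\ a \in J, b \in J & z = a * b]) ->
  x \in zspan (fun z => exists a b, [/\ a \in J, p b = 0 & z = a * b] \/
                                    [/\ p a = 0, b \in J & z = a * b]).
Proof.
move=> hB px xJJ; set Q := zspan _.
have KQ z : z \in zspan ker_ideal -> z \in Q.
  apply: zspan_sub => {}z [a [b ab]]; apply: zspan_gen; exists a, b; by right.
have [h hK] := hB ideal_image N Pm nproj idfun nproj_surj.
(* [s] picks representatives of the section, hence is additive and [A]-linear only modulo [IJ]; the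
   correction terms below come from this. *)
pose s u := nrepr (h (jm_image u)).
have sE u : npi (s u) = h (jm_image u) by rewrite nreprK.
have sp u : p (val (s u)) = p (val u).
  by have /(congr1 val) := hK (jm_image u).
(* [u - s u] represents the projection to [I/IJ]; the elements for which it lies in [JI + IJ] form a
   subgroup containing all products of two elements of [J]. *)
pose H := fun x : A => `[< exists u : Jm, val u = x /\ x - val (s u) \in Q >].
have : x \in (H : {pred A}).
  move/zspanP: xJJ; apply.
    split=> [|_ _ /asboolP[u [<- uQ]] /asboolP[v [<- vQ]]]; apply/asboolP.
      exists 0; split=> //; rewrite sub0r rpredN; apply: KQ.
      rewrite -[val _]subr0; apply/(npi_eq (s 0) 0); rewrite sE.
      by rewrite (_ : jm_image 0 = 0) ?linear0 ?npi0 //; apply/jm_image_ker; rewrite /= rmorph0.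
    exists (u - v); split=> //.
    have -> : val u - val v - val (s (u - v)) = (val u - val (s u)) - (val v - val (s v))
      + (val (s u - s v) - val (s (u - v))).
      by rewrite [val (s u - s v)](_ : _ = val (s u) - val (s v)) // addrA
         [_ - _ - (val v - _)](_ : _ = val u - val v - (val (s u) - val (s v)))
         ?subrK // !opprD addrACA.
    apply: rpredD; first exact: rpredB.
    by apply/KQ/npi_eq; rewrite npiB !sE jm_imageB linearB.
  move=> _ [a [b [aJ bJ ->]]]; apply/asboolP.
  pose u : Jm := @Submod _ A^o ideal_left b bJ.
  exists (a *: u); split=> //.
  have -> : a * b - val (s (a *: u)) = a * (b - val (s u)) + (val (a *: s u) - val (s (a *: u))).
    by rewrite [val (a *: _)](_ : _ = a * val (s u)) // mulrBr addrA subrK.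
  apply: rpredD.
    apply: zspan_gen; exists a, (b - val (s u)); left; split=> //.
    by rewrite rmorphB sp subrr.
  apply/KQ/npi_eq; rewrite sE jm_imageZ linearZ /= -sE.
  by rewrite -[LHS]nscaleE.
(* Since [x] is in [I], the section is evaluated at 0, so [s u] itself lies in [IJ]. *)
case/asboolP=> u [ux xQ]; rewrite -[x](subrK (val (s u))); apply: rpredD => //.
apply: KQ; rewrite -[val _]subr0; apply/(npi_eq (s u) 0); rewrite sE.
rewrite (_ : jm_image u = 0) ?linear0 ?npi0 //; apply/jm_image_ker; rewrite ux //.
Qed.
End HereditaryKernel.

(** * The degree filtration of a tensor algebra *)

Section Filtration.
Variables (k : fieldType) (D : kalgType k) (M : bimod D D).
Local Notation TA := (talg M).

(** In terms of the ideal [J] of tensors of positive degree, this is the power [J^n]. *)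
Definition tge (n : nat) : {pred TA} :=
  fun x => `[< forall m, (m < n)%N -> (x : dsum _) m = 0 >].

Lemma tgeP n (x : TA) :
  reflect (forall m, (m < n)%N -> (x : dsum _) m = 0) (x \in tge n).
Proof. exact: asboolP. Qed.

Lemma tge0 x : x \in tge 0. Proof. exact/tgeP. Qed.

Fact tge_zmod_closed n : zmod_closed (tge n).
Proof.
split=> [|x y /tgeP xn /tgeP yn]; apply/tgeP => m lt_mn //.
have E : ((x - y : TA) : dsum _) m = (x : dsum _) m - (y : dsum _) m by [].
by rewrite E xn ?yn ?subr0.
Qed.
HB.instance Definition _ n := GRing.isZmodClosed.Build TA (tge n) (tge_zmod_closed n).

Lemma tgeM m n (x y : TA) : x \in tge m -> y \in tge n -> x * y \in tge (m + n).
Proof.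
move=> /tgeP xm /tgeP yn; apply/tgeP => q ltq.
rewrite [LHS](tmulrE x y q) big1 // => i _; rewrite big1 // => j _.
have [Eq|neq] := eqVneq (i + j)%N q; last exact: thomog_neq.
have [lti|lei] := ltnP i m; first by rewrite xm // tmul0l thomog0.
have ltj : (j < n)%N.
  rewrite -(ltn_add2l m); apply: leq_ltn_trans ltq.
  by apply: leq_trans (eq_leq Eq); rewrite leq_add2r.
by rewrite yn // tmul0r thomog0.
Qed.

Fact tgeMl n a x : x \in tge n -> a * x \in tge n.
Proof. exact: (@tgeM 0 n a x (tge0 a)). Qed.
Fact tgeMr n a x : x \in tge n -> x * a \in tge n.
Proof. by move=> /tgeM/(_ (tge0 a)); rewrite addn0. Qed.
HB.instance Definition _ n := isIdeal2.Build TA (tge n) (@tgeMl n) (@tgeMr n).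

Lemma thomog_tge m n (x : tpow M n) : (m <= n)%N -> thomog x \in tge m.
Proof.
move=> le_mn; apply/tgeP => q lt_qm; apply: thomog_neq.
by rewrite neq_ltn (leq_trans lt_qm le_mn) orbT.
Qed.

Lemma tdeg1_tge x : tdeg1 x \in tge 1. Proof. exact: thomog_tge. Qed.

Lemma talgE (x : TA) : exists N, x = \sum_(i < N) thomog ((x : dsum _) i).
Proof.
have /finsuppP[N xN] := dsum_valP x; exists N; exact: (dsumE xN).
Qed.

(** Every tensor of positive degree splits off its leftmost factor, which lowers the degree by
    one. *)
Lemma tgeS_span n (x : TA) : x \in tge n.+1 ->
  x \in zspan (fun z : TA => exists m (y : TA), y \in tge n /\ z = tdeg1 m * y).
Proof.
move=> /tgeP xn; set X := fun z => _; have [N ->] := talgE x.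
apply: rpred_sum => -[i iN] _; rewrite [nat_of_ord _]/=.
have [lt_in|] := ltnP i n.+1; first by rewrite xn // thomog0 rpred0.
case: i {iN} => // i; rewrite ltnS => le_ni.
move: ((x : dsum _) i.+1) => t.
apply: (@thomog_tens_ind _ _ M i (fun z => z \in zspan X)) => [m y|s s' ? ?].
  rewrite tmulr_tens; apply: zspan_gen; exists m, (thomog y); split=> //.
  exact: thomog_tge.
exact: (@rpredD TA (zspan X)).
Qed.

Lemma tge2_span (x : TA) : x \in tge 2 ->
  x \in zspan (fun z : TA => exists a b, [/\ a \in tge 1, b \in tge 1 & z = a * b]).
Proof.
move=> /tgeS_span; apply: zspan_sub => y [m [z [z1 ->]]].
by apply: zspan_gen; exists (tdeg1 m), z; split=> //; apply: tdeg1_tge.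
Qed.

Lemma tdeg0_mod (x : TA) : x - tdeg0 M ((x : dsum _) 0) \in tge 1.
Proof.
apply/tgeP => -[|//] _; rewrite -[LHS]/((x : dsum _) 0 - _).
by apply/eqP; rewrite subr_eq0; apply/eqP/esym/thomogE.
Qed.

Lemma tpow1E (t : tpow M 1) : exists m, t = tens m (tunit M).
Proof.
elim/tensor_ind: t => [m d|_ _ [m ->] [n ->]]; last by exists (m + n); rewrite tensDl.
exists (ract m d); rewrite tensA; congr tens; exact: (esym (mulr1 _)).
Qed.

Lemma tdeg1_mod (x : TA) : x \in tge 1 -> exists m, x - tdeg1 m \in tge 2.
Proof.
move=> /tgeP x1; have [m Em] := tpow1E ((x : dsum _) 1); exists m.
apply/tgeP => -[_|[_|//]].
  rewrite -[LHS]/((x : dsum _) 0 - _) x1 //.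
  by apply/eqP; rewrite subr_eq0; apply/eqP/esym/thomog_neq.
rewrite -[LHS]/((x : dsum _) 1 - _) Em.
by apply/eqP; rewrite subr_eq0; apply/eqP/esym/thomogE.
Qed.

(** The degree 1 part of [tdeg1 m] is [m (x) 1], and the right action, as a map from [M (x)_D D] to
    [M], sends it back to [m]. *)
Lemma tdeg1_inj (m : M) : tdeg1 m \in tge 2 -> m = 0.
Proof.
move=> /tgeP/(_ 1%N isT); rewrite [LHS]thomogE => E.
have bal : balanced (fun (x : M) (d : regular_bimod D) => ract x (d : D)).
  have [_ _ _ _ rDl rDr r1 rA _ _] := bimodP M.
  by split=> [*|*|n d p]; [apply: rDl | apply: rDr | apply: rA].
have := congr1 (tlift (fun (x : M) (d : regular_bimod D) => ract x (d : D))) E.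
rewrite (tlift_tens bal) (bimod_r1 (bimodP M)) => ->.
by apply: (addrI (tlift (fun (x : M) (d : regular_bimod D) => ract x (d : D)) 0));
   rewrite -(tliftD bal) !addr0.
Qed.

Fact tdeg1_zmod_morphism : zmod_morphism (@tdeg1 k D M : M -> TA).
Proof.
move=> x y; apply: (addIr (tdeg1 y)); rewrite subrK /tdeg1.
by rewrite -(@thomogD _ _ M 1) -tensDl subrK.
Qed.
HB.instance Definition _ :=
  GRing.isZmodMorphism.Build M TA (@tdeg1 k D M) tdeg1_zmod_morphism.

Lemma tdeg1_lact d m : tdeg1 (lact d m) = tdeg0 M d * tdeg1 m :> TA.
Proof. by rewrite [RHS]tmulr_homog /= tlactE. Qed.

Lemma tdeg1_ract m d : tdeg1 (ract m d) = tdeg1 m * tdeg0 M d :> TA.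
Proof.
rewrite [RHS]tmulr_homog (@tmulSE _ _ _ 0) /tdeg1 tensA.
by congr (@thomog _ _ _ 1 (tens m _)); apply: (etrans (mulr1 _) (esym (mul1r _))).
Qed.
End Filtration.
Arguments tge {k D} M n.

(** * Universal property of tensor algebras *)

Section MkRmorphism.
Variables (A B : pzRingType) (f : A -> B).
Hypotheses (fB : zmod_morphism f) (fM : monoid_morphism f).
(** The proofs are arguments of this copy of [f], so that the instances still find them once the
    section is closed. *)
Definition mk_rmorphism of zmod_morphism f & monoid_morphism f := f.
Local Notation F := (mk_rmorphism fB fM).
HB.instance Definition _ := GRing.isZmodMorphism.Build A B F fB.
HB.instance Definition _ := GRing.isMonoidMorphism.Build A B F fM.
Lemma rmorphism_exists : exists g : {rmorphism A -> B}, g =1 f.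
Proof. by exists F. Qed.
End MkRmorphism.

Section MkAdditive.
Variables (A B : zmodType) (f : A -> B) (fB : zmod_morphism f).
Definition mk_additive of zmod_morphism f := f.
Local Notation F := (mk_additive fB).
HB.instance Definition _ := GRing.isZmodMorphism.Build A B F fB.
Lemma additive_exists : exists g : {additive A -> B}, g =1 f.
Proof. by exists F. Qed.
End MkAdditive.

Lemma rmorphism_inverse (A B : pzRingType) (f : {rmorphism A -> B}) :
  bijective f -> exists g : {rmorphism B -> A}, cancel f g /\ cancel g f.
Proof.
case=> g fK gK.
have gB : zmod_morphism g by exact: can2_zmod_morphism fK gK.
have gM : monoid_morphism g by exact: can2_monoid_morphism fK gK.
have [g' E] := rmorphism_exists gB gM.
by exists g'; split=> x; rewrite E.
Qed.

Section AlgIso.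
Variable k : fieldType.

Lemma alg_iso_sym (A B : kalgType k) : alg_iso A B -> alg_iso B A.
Proof.
case=> f [fk /rmorphism_inverse[g [fK gK]]]; exists g; split; last by exists f.
by move=> c; rewrite -fk fK.
Qed.

Lemma alg_iso_trans (A B C : kalgType k) : alg_iso A B -> alg_iso B C -> alg_iso A C.
Proof.
case=> f [fk fb] [g [gk gb]]; exists (g \o f : {rmorphism A -> C}).
by split; [move=> c; rewrite /= fk gk | apply: bij_comp].
Qed.

Lemma quot_alg0_iso (A : kalgType k) (I : ideal2 A) :
  (forall x, x \in I -> x = 0) -> alg_iso A (quot_alg I).
Proof.
move=> I0; exists (qpi I : {rmorphism A -> quot_alg I}); split=> //.
exists (fun y => repr (y : Quotient.quot I)) => [x|y]; last by rewrite /= /qpi reprK.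
by apply/eqP; rewrite -subr_eq0; apply/eqP/I0; rewrite -qpi_eq /qpi reprK.
Qed.
End AlgIso.

Section TensorEval.
Variables (k : fieldType) (D : kalgType k) (M : bimod D D) (A : pzRingType).
Variables (h0 : {rmorphism D -> A}) (h1 : {additive M -> A}).
Hypotheses (h1l : forall d m, h1 (lact d m) = h0 d * h1 m)
           (h1r : forall m d, h1 (ract m d) = h1 m * h0 d).

(** On elementary tensors, [x_1 (x) ... (x) x_n (x) d] goes to the product of the [h1 x_i] followed
    by [h0 d]. *)
Fixpoint tpow_eval n : tpow M n -> A :=
  match n with
  | 0 => fun d => h0 d
  | n'.+1 => fun t => tlift (fun x y => h1 x * @tpow_eval n' y) t
  end.

(** The two properties are proved together: balancedness in degree [n+1] needs additivity and
    [D]-linearity in degree [n]. *)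
Fact tpow_eval_lin n :
  (forall s t, @tpow_eval n (s + t) = tpow_eval s + tpow_eval t) /\
  (forall d t, @tpow_eval n (lact d t) = h0 d * tpow_eval t).
Proof.
elim: n => [|n [IHD IHl]]; first by split=> [s t|d t]; [apply: raddfD|apply: rmorphM].
have bal : balanced (fun x y => h1 x * @tpow_eval n y).
  split=> [x x' y|x y y'|x d y]; first by rewrite raddfD mulrDl.
    by rewrite IHD mulrDr.
  by rewrite IHl h1r mulrA.
split=> [s t|d t] /=; first by rewrite (tliftD bal).
elim/tensor_ind: t => [x y|s t Hs Ht].
  by rewrite tlactE !(tlift_tens bal) h1l mulrA.
by rewrite tlactD !(tliftD bal) mulrDr Hs Ht.
Qed.

Lemma tpow_evalD n : {morph @tpow_eval n : s t / s + t}.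
Proof. by case: (tpow_eval_lin n). Qed.
Lemma tpow_eval_lact n d t : @tpow_eval n (lact d t) = h0 d * tpow_eval t.
Proof. by case: (tpow_eval_lin n). Qed.
Lemma tpow_eval0 n : @tpow_eval n 0 = 0.
Proof. by apply: (addrI (tpow_eval (0 : tpow M n))); rewrite -tpow_evalD !addr0. Qed.

Lemma tpow_eval_tens n x y : @tpow_eval n.+1 (tens x y) = h1 x * tpow_eval y.
Proof.
apply: (tlift_tens (f := fun x y => h1 x * @tpow_eval n y)).
split=> [x' x'' z|x' z z'|x' d z]; first by rewrite raddfD mulrDl.
  by rewrite tpow_evalD mulrDr.
by rewrite tpow_eval_lact h1r mulrA.
Qed.

Lemma tpow_eval_tmul m n (s : tpow M m) (t : tpow M n) :
  tpow_eval (tmul s t) = tpow_eval s * tpow_eval t.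
Proof.
elim: m s => [|m IHm] s; first exact: tpow_eval_lact.
elim/tensor_ind: s => [x y|s s' Hs Hs'].
  by rewrite tmulSE !(@tpow_eval_tens (m + n)) tpow_eval_tens IHm mulrA.
by rewrite tmulDl (@tpow_evalD (m.+1 + n)) (@tpow_evalD m.+1) mulrDl Hs Hs'.
Qed.

(** A bound on the support, extracted by choice; [talg_evalE] shows that the evaluation does not
    depend on it. *)
Definition talg_bound (x : talg M) : nat :=
  projT1 (cid (elimT (finsuppP _) (dsum_valP x))).
Definition talg_eval (x : talg M) : A :=
  \sum_(i < talg_bound x) tpow_eval ((x : dsum _) i).

Lemma talg_evalE (x : talg M) N : (forall n, (N <= n)%N -> (x : dsum _) n = 0) ->
  talg_eval x = \sum_(i < N) tpow_eval ((x : dsum _) i).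
Proof.
rewrite /talg_eval /talg_bound; case: cid => N' /= xN' xN.
have wid a b : (a <= b)%N -> (forall n, (a <= n)%N -> (x : dsum _) n = 0) ->
    \sum_(i < a) tpow_eval ((x : dsum _) i) = \sum_(i < b) tpow_eval ((x : dsum _) i).
  move=> le_ab xa; rewrite (big_ord_widen _ (fun i => tpow_eval ((x : dsum _) i)) le_ab).
  rewrite big_mkcond; apply: eq_bigr => i _; case: ltnP => // /xa ->.
  by rewrite tpow_eval0.
rewrite (wid _ (maxn N N')) ?leq_maxr // [RHS](wid _ (maxn N N')) ?leq_maxl //.
Qed.

Lemma talg_eval_homog n (t : tpow M n) : talg_eval (thomog t) = tpow_eval t.
Proof.
rewrite (@talg_evalE _ n.+1) => [|m lt_nm]; last by apply: thomog_neq; rewrite neq_ltn lt_nm.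
rewrite big_ord_recr big1 => [|i _]; first by rewrite [LHS]add0r (thomogE t).
by rewrite (thomog_neq t) ?tpow_eval0 // eq_sym ltn_eqF // (ltn_ord i).
Qed.

Lemma talg_evalD : {morph talg_eval : x y / x + y}.
Proof.
move=> x y; have /finsuppP[a xa] := dsum_valP x; have /finsuppP[b yb] := dsum_valP y.
have xm n : (maxn a b <= n)%N -> (x : dsum _) n = 0.
  by rewrite geq_max => /andP[/xa].
have ym n : (maxn a b <= n)%N -> (y : dsum _) n = 0.
  by rewrite geq_max => /andP[_ /yb].
rewrite (talg_evalE xm) (talg_evalE ym) (@talg_evalE _ (maxn a b)).
  by rewrite -big_split; apply: eq_bigr => i _; apply: tpow_evalD.
by move=> n len; rewrite -[LHS]/((x : dsum _) n + (y : dsum _) n) xm // ym // addr0.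
Qed.

Lemma talg_eval0 : talg_eval 0 = 0.
Proof. by apply: (addrI (talg_eval 0)); rewrite -talg_evalD !addr0. Qed.

Lemma talg_evalM : {morph talg_eval : x y / x * y}.
Proof.
elim/dsum_ind => [|x x' Hx Hx'|m s] y; first by rewrite mul0r talg_eval0 mul0r.
  by rewrite mulrDl !talg_evalD mulrDl Hx Hx'.
elim/dsum_ind: y => [|y y' Hy Hy'|n t]; first by rewrite mulr0 talg_eval0 mulr0.
  by rewrite mulrDr !talg_evalD mulrDr Hy Hy'.
by rewrite [_ * _](tmulr_homog s t) !talg_eval_homog tpow_eval_tmul.
Qed.

Lemma talg_eval_tdeg0 d : talg_eval (tdeg0 M d) = h0 d.
Proof. exact: (talg_eval_homog (d : tpow M 0)). Qed.
Lemma talg_eval_tdeg1 m : talg_eval (tdeg1 m) = h1 m.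
Proof. by rewrite talg_eval_homog tpow_eval_tens /= rmorph1 mulr1. Qed.

Lemma talg_rmorphism_exists : exists f : {rmorphism talg M -> A},
  (forall d, f (tdeg0 M d) = h0 d) /\ (forall m, f (tdeg1 m) = h1 m).
Proof.
have fB : zmod_morphism talg_eval.
  by move=> x y; apply: (addIr (talg_eval y)); rewrite subrK -talg_evalD subrK.
have fM : monoid_morphism talg_eval.
  split; last exact: talg_evalM.
  by rewrite -(rmorph1 h0) -talg_eval_tdeg0.
have [f E] := rmorphism_exists fB fM; exists f.
by split=> x; rewrite E ?talg_eval_tdeg0 ?talg_eval_tdeg1.
Qed.
End TensorEval.

(** The tensor algebra is generated in degrees 0 and 1: induction on the degree peels off the
    leftmost factor. *)
Lemma talg_rmorphism_ext (k : fieldType) (D : kalgType k) (M : bimod D D)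
    (A : pzRingType) (f g : {rmorphism talg M -> A}) :
  (forall d, f (tdeg0 M d) = g (tdeg0 M d)) ->
  (forall m, f (tdeg1 m) = g (tdeg1 m)) -> f =1 g.
Proof.
move=> fg0 fg1.
have fgD (x y : talg M) : f x = g x -> f y = g y -> f (x + y) = g (x + y).
  by rewrite !rmorphD => -> ->.
elim/dsum_ind => [|//|n t]; first exact: etrans (rmorph0 f) (esym (rmorph0 g)).
elim: n t => [|n IHn] t; first exact: fg0.
apply: (@thomog_tens_ind _ _ M n (fun x => f x = g x)) => [m y|//].
rewrite tmulr_tens -[tmulr _ _]/(tdeg1 m * thomog y) !rmorphM fg1.
by congr (_ * _); apply: IHn.
Qed.

(** Both directions come from the universal property, whose uniqueness part identifies the
    composites with the identities. *)
Lemma talg_iso (k : fieldType) (D D' : kalgType k) (M : bimod D D) (M' : bimod D' D')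
    (h0 : {rmorphism D -> D'}) (h1 : {additive M -> M'}) :
  alg_hom h0 -> bijective h0 -> bijective h1 ->
  (forall d m, h1 (lact d m) = lact (h0 d) (h1 m)) ->
  (forall m d, h1 (ract m d) = ract (h1 m) (h0 d)) ->
  alg_iso (talg M) (talg M').
Proof.
move=> h0k /rmorphism_inverse[g0 [h0K g0K]] [g1 h1K g1K] h1l h1r.
have g1B : zmod_morphism g1 by exact: can2_zmod_morphism h1K g1K.
have g1l d m : g1 (lact d m) = lact (g0 d) (g1 m).
  by apply: (can_inj h1K); rewrite h1l !g1K g0K.
have g1r m d : g1 (ract m d) = ract (g1 m) (g0 d).
  by apply: (can_inj h1K); rewrite h1r !g1K g0K.
have [g1' g1E] := additive_exists g1B.
have [||f [f0 f1]] := @talg_rmorphism_exists k D M (talg M')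
  (tdeg0 M' \o h0 : {rmorphism _ -> _}) (tdeg1 (M := M') \o h1 : {additive _ -> _}).
- by move=> d m /=; rewrite h1l tdeg1_lact.
- by move=> d m /=; rewrite h1r tdeg1_ract.
have [||g [gg0 gg1]] := @talg_rmorphism_exists k D' M' (talg M)
  (tdeg0 M \o g0 : {rmorphism _ -> _}) (tdeg1 (M := M) \o g1' : {additive _ -> _}).
- by move=> d m /=; rewrite !g1E g1l tdeg1_lact.
- by move=> d m /=; rewrite !g1E g1r tdeg1_ract.
exists f; split; first by move=> c; rewrite [LHS]f0 /= h0k.
exists g.
  apply: (talg_rmorphism_ext (f := g \o f) (g := idfun)) => x /=.
    by rewrite f0 [LHS]gg0 /= h0K.
  by rewrite f1 [LHS]gg1 /= g1E h1K.
apply: (talg_rmorphism_ext (f := f \o g) (g := idfun)) => x /=.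
  by rewrite gg0 [LHS]f0 /= g0K.
by rewrite gg1 [LHS]f1 /= g1E g1K.
Qed.

(** * Tensor algebras of species *)

Section BimodSum.
Variables (k : fieldType) (A B : kalgType k) (N : bimod A B).

Lemma lact_suml I r (P : pred I) (F : I -> A) (m : N) :
  lact (\sum_(i <- r | P i) F i) m = \sum_(i <- r | P i) lact (F i) m.
Proof.
elim/big_rec2: _ => [|i x y _ <-]; last by rewrite (bimod_lDl (bimodP N)).
by apply: (addrI (lact (0 : A) m)); rewrite -(bimod_lDl (bimodP N)) !addr0.
Qed.

Lemma tens0r (C : kalgType k) (P : bimod B C) (n : N) : tens n (0 : P) = 0.
Proof. by apply: (addrI (tens n (0 : P))); rewrite -tensDr !addr0. Qed.

Lemma tens_sumr (C : kalgType k) (P : bimod B C) (n : N) I r (Q : pred I) (F : I -> P) :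
  tens n (\sum_(i <- r | Q i) F i) = \sum_(i <- r | Q i) tens n (F i).
Proof. by elim/big_rec2: _ => [|i x y _ <-]; rewrite ?tens0r ?tensDr. Qed.
End BimodSum.

Section Species.
Variables (k : fieldType) (S : species k).
Local Notation D := (sring S).
Local Notation M := (smod_bimod S).
Local Notation TA := (tensor_alg S).
Local Notation funE := functional_extensionality_dep.

Lemma slact0 (j i : vert S) (d : sdiv S j) : slact d (0 : sbim S j i) = 0.
Proof. by apply: (addrI (slact d (0 : sbim S j i))); rewrite -(bimod_lDr (sbimP j i)) !addr0. Qed.
Lemma slact0l (j i : vert S) (m : sbim S j i) : slact (0 : sdiv S j) m = 0.
Proof. by apply: (addrI (slact (0 : sdiv S j) m)); rewrite -(bimod_lDl (sbimP j i)) !addr0. Qed.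
Lemma sract0 (j i : vert S) (d : sdiv S i) : sract (0 : sbim S j i) d = 0.
Proof. by apply: (addrI (sract (0 : sbim S j i) d)); rewrite -(bimod_rDl (sbimP j i)) !addr0. Qed.
Lemma sract0r (j i : vert S) (m : sbim S j i) : sract m (0 : sdiv S i) = 0.
Proof. by apply: (addrI (sract m (0 : sdiv S i))); rewrite -(bimod_rDr (sbimP j i)) !addr0. Qed.

Lemma sring_injE i (d : sdiv S i) : sring_inj d i = d.
Proof. by rewrite /sring_inj; case: eqP => // e; rewrite (eq_axiomK e). Qed.
Lemma sring_inj_neq i j (d : sdiv S i) : i != j -> sring_inj d j = 0.
Proof. by rewrite /sring_inj; case: eqP. Qed.
Lemma smod_injE j i (m : sbim S j i) : smod_inj m (j, i) = m.
Proof. by rewrite /smod_inj; case: eqP => // e; rewrite (eq_axiomK e). Qed.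
Lemma smod_inj_neq j i (m : sbim S j i) q : (j, i) != q -> smod_inj m q = 0.
Proof. by rewrite /smod_inj; case: eqP. Qed.

Lemma sringDE (a b : D) i : (a + b) i = a i + b i. Proof. by []. Qed.
Lemma sringBE (a b : D) i : (a - b) i = a i - b i. Proof. by []. Qed.
Lemma sringME (a b : D) i : (a * b) i = a i * b i. Proof. by []. Qed.

Lemma smod_inj_inj j i : injective (@smod_inj k S j i).
Proof. by move=> x y /(congr1 (fun s : smod S => s (j, i))); rewrite !smod_injE. Qed.

Lemma sring_sumE I r (P : pred I) (F : I -> D) i :
  (\sum_(j <- r | P j) F j) i = \sum_(j <- r | P j) F j i.
Proof. by elim/big_rec2: _ => // j x y _ <-. Qed.
Lemma sringE (a : D) : a = \sum_i sring_inj (a i).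
Proof.
apply: funE => i; rewrite sring_sumE (bigD1 i) //= sring_injE big1 ?addr0 //.
by move=> j ji; rewrite sring_inj_neq.
Qed.

Fact smod_inj_zmod_morphism j i : zmod_morphism (@smod_inj k S j i).
Proof.
move=> x y; apply: funE => q; rewrite -[RHS]/(smod_inj x q - smod_inj y q).
have [<-|ne] := eqVneq (j, i) q; first by rewrite !smod_injE.
by rewrite !smod_inj_neq // subrr.
Qed.
HB.instance Definition _ j i :=
  GRing.isZmodMorphism.Build (sbim S j i) (smod S) (@smod_inj k S j i)
    (@smod_inj_zmod_morphism j i).

Lemma smod_lact_inj (d : D) j i (m : sbim S j i) :
  smod_lact d (smod_inj m) = smod_inj (slact (d j) m).
Proof.
apply: funE => q; rewrite /smod_lact.
have [<-|ne] := eqVneq (j, i) q; first by rewrite !smod_injE.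
by rewrite !smod_inj_neq // slact0.
Qed.
Lemma smod_ract_inj (d : D) j i (m : sbim S j i) :
  smod_ract (smod_inj m) d = smod_inj (sract m (d i)).
Proof.
apply: funE => q; rewrite /smod_ract.
have [<-|ne] := eqVneq (j, i) q; first by rewrite !smod_injE.
by rewrite !smod_inj_neq // sract0.
Qed.
(** For [d = d' = 1] this is multiplication by the vertex idempotents [e_j] and [e_i], which cuts
    out the component [{}_jM_i]. *)
Lemma smod_component (m : smod S) j i (d : sdiv S j) (d' : sdiv S i) :
  smod_lact (sring_inj d) (smod_ract m (sring_inj d')) =
  smod_inj (slact d (sract (m (j, i)) d')).
Proof.
apply: funE => -[j' i']; rewrite /smod_lact /smod_ract /=.
have [Ej|nj] := eqVneq j j'; last first.
  by rewrite sring_inj_neq // slact0l smod_inj_neq // xpair_eqE (negPf nj).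
have [Ei|ni] := eqVneq i i'; last first.
  rewrite [X in sract _ X]sring_inj_neq // sract0r slact0 smod_inj_neq //.
  by rewrite xpair_eqE (negPf ni) andbF.
by case: j' / Ej; case: i' / Ei; rewrite smod_injE !sring_injE.
Qed.

Lemma arrow_elt_lact j i (d : sdiv S j) (m : sbim S j i) :
  arrow_elt (slact d m) = tdeg0 M (sring_inj d) * arrow_elt m.
Proof. by rewrite -tdeg1_lact [lact _ _]smod_lact_inj sring_injE. Qed.
Lemma arrow_elt_ract j i (m : sbim S j i) (d : sdiv S i) :
  arrow_elt (sract m d) = arrow_elt m * tdeg0 M (sring_inj d).
Proof. by rewrite -tdeg1_ract [ract _ _]smod_ract_inj sring_injE. Qed.
Lemma tdeg1_component (m : smod S) j i (d : sdiv S j) (d' : sdiv S i) :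
  tdeg0 M (sring_inj d) * (tdeg1 (m : M) * tdeg0 M (sring_inj d')) =
  arrow_elt (slact d (sract (m (j, i)) d')).
Proof. by rewrite -tdeg1_ract -tdeg1_lact; congr tdeg1; apply: smod_component. Qed.

Lemma sbim_no_arrow (j i : vert S) (m : sbim S j i) : ~~ arrow i j -> m = 0.
Proof.
rewrite negbK dimv_eq0 => /eqP E; apply/eqP.
by rewrite -memv0 -E memvf.
Qed.

Lemma lact_vert_sum (N : bimod D D) (x : N) :
  x = \sum_(i : vert S) lact (sring_inj (1 : sdiv S i)) x.
Proof. by rewrite -lact_suml -(sringE 1) (bimod_l1 (bimodP N)). Qed.

(** * Acyclic quivers and trees *)

Section Acyclic.
Hypothesis acyc : no_oriented_cycle S.

Lemma acyclic_connect (i j : vert S) : arrow i j -> connect (@arrow k S) j i -> False.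
Proof.
move=> ij /connectP[p jp Ei]; suff : j :: p = [::] by [].
by apply: acyc; rewrite /= rcons_path jp -Ei.
Qed.

(** A nonzero tensor of degree [n] ending in [b] needs a path of length [n] into [b]; by acyclicity
    its [n+1] vertices are distinct, and all of them reach [b]. The induction removes the last
    arrow. *)
Lemma tpow_nilpotent n (b : vert S) (t : tpow M n) :
  (#|[pred a | connect (@arrow k S) a b]| <= n)%N -> lact (sring_inj (1 : sdiv S b)) t = 0.
Proof.
elim: n b t => [|n IHn] b t le_n.
  suff : false by [].
  by move: le_n; rewrite leqn0 => /eqP/card0_eq/(_ b); rewrite !inE connect0.
elim/tensor_ind: t => [x y|s t Hs Ht]; last first.
  by rewrite (bimod_lDr (bimodP (tpow M n.+1))) Hs Ht addr0.
rewrite [LHS]tlactE [y in tens _ y]lact_vert_sum tens_sumr big1 // => a _.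
have [ab|nab] := boolP (arrow a b).
  (* Everything that reaches [a] reaches [b], whereas [b] does not reach [a], so the count for [a]
     is strictly smaller. *)
  rewrite IHn ?tens0r // -ltnS (leq_trans _ le_n) //; apply: proper_card.
  apply/properP; split; last first.
    exists b; rewrite !inE ?connect0 //; apply/negP; exact: acyclic_connect ab.
  by apply/subsetP => c; rewrite !inE => /connect_trans; apply; apply: connect1.
(* Moving [e_a] across the tensor sign leaves [e_b x e_a], which lies in a zero bimodule when there
   is no arrow from [a] to [b]. *)
rewrite -tensA -[ract _ _]/(smod_ract (smod_lact _ _) _).
rewrite [X in tens X](_ : _ = 0) ?tens0l //.
rewrite [LHS](bimod_lr (bimodP M)) [LHS]smod_component.
by rewrite (sbim_no_arrow (slact _ _) nab) raddf0.
Qed.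

Lemma tge_bounded : exists N, forall x : TA, x \in tge M N -> x = 0.
Proof.
exists #|vert S| => x /tgeP xn; apply: dsumP => n; rewrite dsum0E.
have [/xn //|le_n] := ltnP n #|vert S|.
rewrite [LHS]lact_vert_sum big1 // => b _; apply: tpow_nilpotent.
exact: leq_trans (max_card _) le_n.
Qed.
Lemma etensor_connect (a b : vert S) (g : etensor a b) : connect (@arrow k S) a b.
Proof.
elim: g => [c ac _|c d cd _ _ ac]; first exact: connect1.
exact: connect_trans ac (connect1 cd).
Qed.

Lemma etensor_irrefl (a : vert S) (g : etensor a a) : False.
Proof.
(* The index is separated from the parameter [a] to allow case analysis. *)
have: forall b, etensor a b -> b = a -> False.
  move=> b; case=> [c ac _|c d cd _ g'] E.
    by apply: (acyclic_connect ac); rewrite E connect0.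
  by apply: (acyclic_connect cd); rewrite E; apply: etensor_connect.
by move/(_ a g erefl).
Qed.

(* The direct arrow would close the path [a -> ... -> c -> b] into a cycle of
   length at least 3. *)
Lemma tree_no_shortcut (a b c : vert S) :
  is_tree S -> etensor a c -> arrow c b -> ~~ arrow a b.
Proof.
move=> [_ tree] g cb; apply/negP => ab.
have [p0 ap0 Ec0] := connectP (etensor_connect g).
case/shortenP: ap0 Ec0 => p ap up _ Ec {p0}.
have p0 : p != [::].
  by apply/eqP => p0; move: g; rewrite Ec p0 /= => /etensor_irrefl.
(* If [b] were on the path, the rest of the path would lead from [b] to [c], and the arrow from [c]
   to [b] would close an oriented cycle. *)
have nbp : b \notin a :: p.
  apply/negP => bp; apply: (acyclic_connect cb); move: ap Ec {p0 up}.
  case/splitPl: bp => p1 p2 Eb; rewrite cat_path last_cat Eb => /andP[_ p2P] ->.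
  by apply/connectP; exists p2.
have := tree (rcons (a :: p) b); rewrite rcons_uniq nbp up => /(_ _ isT)/negP; apply.
  by rewrite size_rcons /= !ltnS lt0n size_eq0.
rewrite /= rcons_path last_rcons ab orbT andbT rcons_path -Ec cb andbT.
by apply: sub_path ap => x y /= ->.
Qed.

Lemma et_eval_tge1 (a b : vert S) (g : etensor a b) : et_eval g \in tge M 1.
Proof.
case: g => [c ac m|c d cd m g] /=; first exact: tdeg1_tge.
by apply: tgeMr; apply: tdeg1_tge.
Qed.

(** A summand outside [{}_jM_i] follows a path of length at least 2 from [i] to [j]. In a tree this
    excludes an arrow from [i] to [j], so all the summands have degree at least 2. *)
Lemma relation_tge2 (s : relation S) : is_tree S ->
  strong_canonical_relation s -> rel_elt s \in tge M 2.
Proof.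
move=> tree [[l [lt_l _ uniq_l]] lt1].
have {uniq_l} [l' lt_l' nl'] : exists2 l', (l' < size (rel_terms s))%N &
    ~ in_sbim (rel_tgt s) (rel_src s) (nth 0 (rel_terms s) l').
  (* The witness is 1 if [l] is 0 and 0 otherwise, an index different from [l] among the first
     two. *)
  exists (l == 0%N : nat); first by apply: leq_ltn_trans lt1; case: (l == 0%N).
  by apply: uniq_l; [apply: leq_ltn_trans lt1|]; case: l {lt_l}.
have no_arrow : ~~ arrow (rel_src s) (rel_tgt s).
  move: lt_l' nl'; rewrite /rel_terms size_map => lt_l'.
  case: (rel_summands s) lt_l' => // g0 gs lt_l'.
  rewrite (nth_map g0) //; case: (nth _ _ _) => [b ab m|c b cb m g] nl'.
    by case: nl'; exists m.
  exact: (tree_no_shortcut tree g cb).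
rewrite /rel_elt /rel_terms big_map; apply: rpred_sum => g _.
case: g no_arrow => [b ab m|c b cb m g] /= nab; first by rewrite ab in nab.
by apply: (@tgeM _ _ _ 1 1); [apply: tdeg1_tge | apply: et_eval_tge1].
Qed.
End Acyclic.
End Species.

(** * Vanishing of the ideal of relations *)

Lemma hereditary_ideal_eq0 (k : fieldType) (L : kalgType k) (S : species k)
    (I : ideal2 (tensor_alg S)) : hereditary L -> no_oriented_cycle S ->
  (forall x, x \in I -> x \in tge (smod_bimod S) 2) ->
  alg_iso L (quot_alg I) -> forall x, x \in I -> x = 0.
Proof.
move=> hL acyc I2 [f [_ /rmorphism_inverse[g [fK gK]]]].
pose p : {rmorphism tensor_alg S -> L} := g \o qpi I.
pose lift l := repr (f l : Quotient.quot I).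
have liftK : cancel lift p by move=> l; rewrite /p /lift /= /qpi reprK fK.
have pE x : p x = 0 <-> x \in I.
  rewrite -[x in x \in I]subr0 -qpi_eq; split=> [/(congr1 f)|/eqP E].
    by rewrite /p /= gK rmorph0 => ->; rewrite rmorph0.
  by rewrite /p /= E !rmorph0.
have kerJ x : p x = 0 -> x \in tge (smod_bimod S) 1.
  by move=> /pE/I2/tgeP x2; apply/tgeP => m lt_m1; apply: x2; apply: ltn_trans lt_m1 _.
(* Each use of the inclusion of [I] in [JI + IJ] gains one degree. *)
have Itge n x : x \in I -> x \in tge (smod_bimod S) n.
  elim: n x => [|n IHn] x xI; first exact: tge0.
  have /(hereditary_kernel liftK kerJ hL) : p x = 0 by apply/pE.
  move=> /(_ (tge2_span (I2 x xI))); apply: zspan_sub => y [a [b]].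
  case=> [[a1 /pE bI ->]|[/pE aI b1 ->]].
    by rewrite -add1n; apply: tgeM => //; apply: IHn.
  by rewrite -addn1; apply: tgeM => //; apply: IHn.
have [N N0] := tge_bounded acyc.
by move=> x xI; apply: N0; apply: Itge.
Qed.

(** * The radical and the species of a tensor algebra *)

Lemma jacobson_kernel (k : fieldType) (S : species k) (A : pzRingType)
    (f : {rmorphism A -> sring S}) :
  (forall d, exists a, f a = d) -> (forall x, f x = 0 -> exists n, x ^+ n = 0) ->
  forall x, x \in jacobson A <-> f x = 0.
Proof.
move=> f_surj f_nil x; split=> [/jacobsonP xJ|fx].
  apply: functional_extensionality_dep => i.
  (* The kernel of the [i]-th coordinate is a maximal left ideal because [D_i] is a division
     ring. *)
  pose K : {pred A^o} := fun x : A => f x i == 0.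
  suff /xJ/eqP : maximal_left_ideal K by [].
  have KM a y : y \in K -> a * y \in K.
    by rewrite !unfold_in rmorphM => /eqP y0; rewrite sringME y0 mulr0.
  split.
  - split=> [|a y z yK]; first by rewrite unfold_in rmorph0.
    move: (KM a y yK); rewrite !unfold_in rmorphD => /eqP ay /eqP z0.
    by rewrite sringDE ay z0 addr0.
  - by rewrite unfold_in rmorph1 oner_eq0.
  move=> K' [K'0 K'l] K'1 KK' z zK'; rewrite unfold_in; apply: contraR K'1 => nz.
  have [a fa] := f_surj (sring_inj (f z i)^-1).
  have : a * z + (1 - a * z) \in K'.
    apply: K'l => //; apply: KK'; rewrite unfold_in rmorphB rmorphM rmorph1 fa.
    rewrite sringBE sringME sring_injE mulVr ?subrr //.
    exact: sdivP.
  by rewrite addrC subrK.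
apply/jacobsonP => K [[K0 Kl] K1 Kmax]; apply/negPn/negP => xK.
have KM c u : u \in K -> c * u \in K.
  by move=> uJ; rewrite -[c * u]addr0; apply: (Kl c).
have KD u v : u \in K -> v \in K -> u + v \in K.
  by move=> uJ vJ; rewrite -[u]mul1r; apply: (Kl 1).
(* [K + Ax] is strictly larger than the maximal left ideal [K], so it contains 1. *)
pose K' : {pred A^o} := fun u => `[< exists v c, v \in K /\ u = v + c * x >].
have K'1 : 1 \in K'.
  apply/negPn/negP => nK'1; case/negP: xK.
  apply: (Kmax K') => //.
  - split; first by apply/asboolP; exists 0, 0; rewrite mul0r addr0.
    move=> c _ _ /asboolP[j [d [jK ->]]] /asboolP[j' [d' [jK' ->]]].
    apply/asboolP; exists (c * j + j'), (c * d + d'); split; first exact: (Kl c).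
    by rewrite [c *: _]mulrDr mulrDl -[c * d * _]mulrA addrACA.
  - by move=> u uK; apply/asboolP; exists u, 0; rewrite mul0r addr0.
  - by apply/asboolP; exists 0, 1; rewrite mul1r add0r.
case/asboolP: K'1 => u [c [uK E]].
have uE : u = 1 - c * x by rewrite E addrK.
have [|n n0] := f_nil (c * x); first by rewrite rmorphM fx mulr0.
(* By the geometric series this is a left multiple of [u = 1 - c * x]; as [(c * x) ^+ n = 0], it
   puts 1 into [K]. *)
have : 1 - (c * x) ^+ n \in K.
  elim: n {n0} => [|n IHn]; first by rewrite expr0 subrr.
  rewrite exprS (_ : 1 - _ = u + c * x * (1 - (c * x) ^+ n)); first by apply: KD => //; apply: KM.
  by rewrite uE mulrBr mulr1 addrA subrK.
by rewrite n0 subr0; apply/negP.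
Qed.

Section IdealPreim.
Variables (A C : pzRingType) (f : {rmorphism A -> C}) (J : ideal2 C).
Definition ideal_preim : {pred A} := fun x => f x \in J.
Fact ideal_preim_zmod_closed : zmod_closed ideal_preim.
Proof.
split=> [|x y xJ yJ]; rewrite unfold_in; first by rewrite rmorph0 rpred0.
by rewrite rmorphB rpredB.
Qed.
HB.instance Definition _ :=
  GRing.isZmodClosed.Build A ideal_preim ideal_preim_zmod_closed.
Fact ideal_preimMl a x : x \in ideal_preim -> a * x \in ideal_preim.
Proof. by rewrite !unfold_in rmorphM; apply: ideal2Ml. Qed.
Fact ideal_preimMr a x : x \in ideal_preim -> x * a \in ideal_preim.
Proof. by rewrite !unfold_in rmorphM; apply: ideal2Mr. Qed.
HB.instance Definition _ := isIdeal2.Build A ideal_preim ideal_preimMl ideal_preimMr.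
End IdealPreim.

Lemma quot_rmorphism_exists (A C : pzRingType) (I : ideal2 A) (f : {rmorphism A -> C}) :
  (forall x, x \in I -> f x = 0) ->
  exists g : {rmorphism quot_alg I -> C}, forall x, g (qpi I x) = f x.
Proof.
move=> fI; pose g (y : quot_alg I) := f (repr (y : Quotient.quot I)).
have gE x : g (qpi I x) = f x.
  apply/eqP; rewrite -subr_eq0 -rmorphB; apply/eqP/fI.
  by rewrite -qpi_eq /qpi reprK.
have gB : zmod_morphism g.
  move=> x y; have [[a ->] [b ->]] := conj (qpi_surj x) (qpi_surj y).
  by rewrite -rmorphB !gE rmorphB.
have gM : monoid_morphism g.
  split=> [|x y]; first by rewrite -(rmorph1 (qpi I)) gE rmorph1.
  have [[a ->] [b ->]] := conj (qpi_surj x) (qpi_surj y).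
  by rewrite -rmorphM !gE rmorphM.
by have [g' E] := rmorphism_exists gB gM; exists g' => x; rewrite E gE.
Qed.

Lemma tdeg0_proj_exists (k : fieldType) (D : kalgType k) (M : bimod D D) :
  exists f : {rmorphism talg M -> D}, forall x, f x = (x : dsum _) 0.
Proof.
have fB : zmod_morphism (fun x : talg M => (x : dsum _) 0 : D) by [].
have fM : monoid_morphism (fun x : talg M => (x : dsum _) 0 : D).
  split=> [|x y]; first exact: (thomogE (tunit M)).
  by rewrite [LHS](tmulrE x y) !big_ord1; apply: (@thomogE _ _ M 0).
by have [f E] := rmorphism_exists fB fM; exists f.
Qed.

Section SpeciesOfTensorAlgebra.
Variables (k : fieldType) (S : species k) (B : kalgType k).
Hypothesis acyc : no_oriented_cycle S.
Local Notation M := (smod_bimod S).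
Local Notation TA := (tensor_alg S).

(** The action on [J/J^2] depends on the acting element only modulo [J]. *)
Lemma tgeM_congl (a a' x x' : TA) : a - a' \in tge M 1 -> x \in tge M 1 ->
  x - x' \in tge M 2 -> a * x - a' * x' \in tge M 2.
Proof.
move=> aa x1 xx; have -> : a * x - a' * x' = (a - a') * x + a' * (x - x').
  by rewrite mulrBl mulrBr addrA subrK.
by apply: rpredD; [apply: (@tgeM _ _ _ 1 1) | apply: tgeMl].
Qed.

Lemma tgeM_congr (a a' x x' : TA) : a - a' \in tge M 1 -> x \in tge M 1 ->
  x - x' \in tge M 2 -> x * a - x' * a' \in tge M 2.
Proof.
move=> aa x1 xx; have -> : x * a - x' * a' = x * (a - a') + (x - x') * a'.
  by rewrite mulrBl mulrBr addrA subrK.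
by apply: rpredD; [apply: (@tgeM _ _ _ 1 1) | apply: tgeMr].
Qed.

(** Under the isomorphism the radical [r] corresponds to [J] and its square to [J^2], so [B/r] and
    [r/r^2] are the parts of degree 0 and 1. *)
Lemma species_of_iso : alg_iso B TA -> is_species_of B S.
Proof.
case=> h [hk /rmorphism_inverse[g [hK gK]]].
have [pr prE] := tdeg0_proj_exists M.
have pr_ker x : pr x = 0 <-> x \in tge M 1.
  rewrite prE; split=> [x0|/tgeP/(_ 0%N isT) //].
  by apply/tgeP => -[|//] _.
have jacE b : b \in jacobson B <-> h b \in tge M 1.
  rewrite -pr_ker; apply: (jacobson_kernel (f := pr \o h : {rmorphism B -> sring S})).
    by move=> d; exists (g (tdeg0 M d)); rewrite /= gK prE [LHS]thomogE.
  move=> x /= /pr_ker x1; have [N N0] := tge_bounded acyc; exists N.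
  apply: (can_inj hK); rewrite rmorph0 rmorphXn; apply: N0.
  elim: N => [|N IHN]; first exact: tge0.
  by rewrite exprS -add1n; apply: tgeM.
have radsqE b : b \in rad_sq B <-> h b \in tge M 2.
  split=> [/ideal_genP/(_ (ideal_preim h (tge M 2)))|b2].
    apply=> _ [x [y [/jacE x1 /jacE y1 ->]]]; rewrite unfold_in rmorphM.
    exact: (@tgeM _ _ _ 1 1).
  pose H : {pred TA} := fun x => g x \in rad_sq B.
  rewrite -[b]hK; move/tge2_span/zspanP: b2 => /(_ H); apply.
    split=> [|x y xH yH]; rewrite unfold_in; first by rewrite rmorph0 rpred0.
    by rewrite rmorphB rpredB.
  move=> _ [x [y [x1 y1 ->]]]; rewrite unfold_in rmorphM; apply/ideal_genP => I.
  by apply; exists (g x), (g y); split=> //; apply/jacE; rewrite gK.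
have rad_eq x y : qpi (rad_sq B) x = qpi (rad_sq B) y <-> h x - h y \in tge M 2.
  by rewrite -rmorphB -radsqE -qpi_eq; split=> /eqP.
have [th thE] := @quot_rmorphism_exists _ _ (jacobson B) (pr \o h : {rmorphism B -> sring S})
  (fun x xJ => proj2 (pr_ker _) (proj1 (jacE _) xJ)).
have th_mod a d : th (qpi (jacobson B) a) = d -> h a - tdeg0 M d \in tge M 1.
  by rewrite thE /= prE => <-; apply: tdeg0_mod.
exists th; split.
- by move=> c; rewrite -[kstr c]/(qpi _ (kstr c)) thE /= hk prE [LHS]thomogE.
- exists (fun d => qpi (jacobson B) (g (tdeg0 M d))) => [y|d].
    have [b ->] := qpi_surj y; rewrite thE; apply/eqP; rewrite qpi_eq.
    by rewrite jacE rmorphB gK -rpredN opprB /= prE tdeg0_mod.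
  by rewrite thE /= gK prE [LHS]thomogE.
move=> j i; pose f : {additive sbim S j i -> quot_alg (rad_sq B)} :=
  qpi (rad_sq B) \o g \o @tdeg1 _ _ M \o @smod_inj _ S j i.
have fmE m : f m = qpi _ (g (arrow_elt m)) by [].
have fE m b : h b - arrow_elt m \in tge M 2 -> qpi (rad_sq B) b = f m.
  by move=> bm; apply/rad_eq; rewrite gK.
exists f; split.
- apply: raddf_inj => m m0; apply: smod_inj_inj; rewrite raddf0.
  apply: (@tdeg1_inj _ _ M); rewrite -[tdeg1 _]subr0 -(rmorph0 h) -[tdeg1 _]gK.
  by apply/rad_eq; rewrite rmorph0.
- move=> y; split=> [|[m ->]].
    pose H : {pred quot_alg (rad_sq B)} := fun y => `[<exists m, y = f m>].
    move=> /zspanP/(_ H) yH; apply/asboolP; apply: yH.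
      split=> [|_ _ /asboolP[m ->] /asboolP[n ->]]; apply/asboolP.
        by exists 0; rewrite raddf0.
      by exists (m - n); rewrite raddfB.
    move=> _ [a [x [b [[d /th_mod ad] /jacE x1 [d' /th_mod bd] ->]]]]; apply/asboolP.
    (* Modulo [J^2] only the degree 1 part [m] of [x] matters, and the factors [a] and [b] select
       its component at [(j, i)]. *)
    have [m xm] := tdeg1_mod x1; exists (slact d (sract (m (j, i)) d')); apply: fE.
    rewrite -tdeg1_component -mulrA !rmorphM; apply: tgeM_congl => //.
      exact: tgeMr.
    exact: tgeM_congr.
  (* Conversely, an element of [{}_jM_i] is fixed by the vertex idempotents of [j] on the left and
     of [i] on the right. *)
  apply: zspan_gen; pose e l := g (tdeg0 M (sring_inj (1 : sdiv S l))).
  exists (e j), (g (arrow_elt m)), (e i); split.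
  + by exists 1; rewrite thE /= gK prE [LHS]thomogE.
  + by apply/jacE; rewrite gK; apply: tdeg1_tge.
  + by exists 1; rewrite thE /= gK prE [LHS]thomogE.
  apply/esym/fE; rewrite !rmorphM !gK -arrow_elt_lact -arrow_elt_ract.
  by rewrite (bimod_l1 (sbimP j i)) (bimod_r1 (sbimP j i)) subrr rpred0.
- move=> d a m /th_mod ad; rewrite (fmE m) -rmorphM; apply/esym/fE; rewrite rmorphM gK.
  by rewrite arrow_elt_lact; apply: tgeM_congl; rewrite ?subrr ?rpred0 ?tdeg1_tge.
- move=> d a m /th_mod ad; rewrite (fmE m) -rmorphM; apply/esym/fE; rewrite rmorphM gK.
  by rewrite arrow_elt_ract; apply: tgeM_congr; rewrite ?subrr ?rpred0 ?tdeg1_tge.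
Qed.
End SpeciesOfTensorAlgebra.

(** * Uniqueness of the species *)

Section SpeciesData.
Variables (k : fieldType) (A : kalgType k) (S : species k).
Local Notation qj := (qpi (jacobson A)).
Local Notation qr := (qpi (rad_sq A)).

Lemma qr_jacobson_mul x y : x \in jacobson A -> y \in jacobson A -> qr x * qr y = 0.
Proof.
move=> xJ yJ; apply/eqP; rewrite -rmorphM -(rmorph0 qr) qpi_eq subr0.
by apply/ideal_genP => I; apply; exists x, y.
Qed.

Lemma qr_jacobson_congl a b x : qj a = qj b -> x \in jacobson A -> qr a * qr x = qr b * qr x.
Proof.
move/eqP; rewrite qpi_eq => ab xJ; apply/eqP.
by rewrite -subr_eq0 -mulrBl -rmorphB qr_jacobson_mul.
Qed.

Lemma qr_jacobson_congr a b x : qj a = qj b -> x \in jacobson A -> qr x * qr a = qr x * qr b.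
Proof.
move/eqP; rewrite qpi_eq => ab xJ; apply/eqP.
by rewrite -subr_eq0 -mulrBr -rmorphB qr_jacobson_mul.
Qed.

(** The componentwise data are assembled into an isomorphism of [D] with [A/r] and a compatible one
    from [M] onto [r/r^2], the form in which two species can be compared. *)
Lemma species_of_smod : is_species_of A S ->
  exists (th : {rmorphism quot_alg (jacobson A) -> sring S})
         (F : {additive smod S -> quot_alg (rad_sq A)}),
  [/\ alg_hom th /\ bijective th, injective F,
      forall y, (exists m, y = F m) <-> (exists2 x, x \in jacobson A & y = qr x),
      forall a m, F (smod_lact (th (qj a)) m) = qr a * F m
    & forall a m, F (smod_ract m (th (qj a))) = F m * qr a].
Proof.
case=> th [thk th_bij H]; exists th.
pose f q := projT1 (cid (H q.1 q.2)).
have fP q := projT2 (cid (H q.1 q.2)).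
have f_inj q : injective (f q) by case: (fP q).
have fE j i : forall y, y \in rad_component th j i <-> exists m, y = f (j, i) m.
  by case: (fP (j, i)).
have th_surj d : exists a, th (qj a) = d.
  case: (th_bij) => g _ gK; have [a Ea] := qpi_surj (g d).
  by exists a; rewrite -Ea gK.
have th_inj a b : th (qj a) = th (qj b) -> qj a = qj b by apply: (bij_inj th_bij).
pose e l := projT1 (cid (th_surj (sring_inj (1 : sdiv S l)))).
have eP l : th (qj (e l)) = sring_inj (1 : sdiv S l) := projT2 (cid (th_surj _)).
have f_rad q m : exists2 x, x \in jacobson A & f q m = qr x.
  case: q m => j i m.
  have : f (j, i) m \in rad_component th j i by apply/fE; exists m.
  pose K : {pred quot_alg (rad_sq A)} := fun y => `[<exists2 x, x \in jacobson A & y = qr x>].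
  move=> /zspanP/(_ K) yK; apply/asboolP; apply: yK.
    split=> [|_ _ /asboolP[x xJ ->] /asboolP[y yJ ->]]; apply/asboolP.
      by exists 0; rewrite ?rpred0 ?rmorph0.
    by exists (x - y); rewrite ?rpredB ?rmorphB.
  move=> _ [a [x [b [_ xJ _ ->]]]]; apply/asboolP; exists (a * x * b) => //.
  by apply: ideal2Mr; apply: ideal2Ml.
(* The given compatibility concerns elements supported at one vertex; as [f q m] is fixed by
   [e q.1], the general [a] is replaced by [a * e q.1]. *)
have f_lact q a m : f q (slact (th (qj a) q.1) m) = qr a * f q m.
  case: (fP q) => _ _ fl _.
  have -> : f q m = qr (e q.1) * f q m by rewrite -(fl _ _ _ (eP _)) (bimod_l1 (sbimP _ _)).
  rewrite mulrA -rmorphM; apply: fl.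
  rewrite !rmorphM eP; apply: functional_extensionality_dep => l; rewrite sringME.
  have [<-|ne] := eqVneq q.1 l; first by rewrite !sring_injE mulr1.
  by rewrite !sring_inj_neq // mulr0.
have f_ract q a m : f q (sract m (th (qj a) q.2)) = f q m * qr a.
  case: (fP q) => _ _ _ fr.
  have -> : f q m = f q m * qr (e q.2) by rewrite -(fr _ _ _ (eP _)) (bimod_r1 (sbimP _ _)).
  rewrite -mulrA -rmorphM; apply: fr.
  rewrite !rmorphM eP; apply: functional_extensionality_dep => l; rewrite sringME.
  have [<-|ne] := eqVneq q.2 l; first by rewrite !sring_injE mul1r.
  by rewrite !sring_inj_neq // mul0r.
pose F0 (m : smod S) := \sum_q f q (m q).
have F0B : zmod_morphism F0.
  by move=> x y; rewrite /F0 -sumrB; apply: eq_bigr => q _; rewrite -raddfB.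
have [F FE] := additive_exists F0B; exists F.
have Fl a m : F (smod_lact (th (qj a)) m) = qr a * F m.
  by rewrite !FE /F0 mulr_sumr; apply: eq_bigr => q _; rewrite -f_lact.
have Fr a m : F (smod_ract m (th (qj a))) = F m * qr a.
  by rewrite !FE /F0 mulr_suml; apply: eq_bigr => q _; rewrite -f_ract.
have F_inj j i (m : sbim S j i) : F (smod_inj m) = f (j, i) m.
  rewrite FE /F0 (bigD1 (j, i)) //= smod_injE big1 ?addr0 // => q ne.
  by rewrite smod_inj_neq 1?eq_sym // raddf0.
split=> //.
  (* Vertex idempotents on both sides reduce injectivity to that of each [f (j, i)]. *)
  apply: raddf_inj => m m0; apply: functional_extensionality_dep => -[j i].
  apply: (f_inj (j, i)); rewrite raddf0 -F_inj.
  have := smod_component m (1 : sdiv S j) (1 : sdiv S i).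
  rewrite (bimod_l1 (sbimP j i)) (bimod_r1 (sbimP j i)) => <-.
  by rewrite -!eP Fl Fr m0 mul0r mulr0.
move=> y; split=> [[m ->]|[x xJ ->]].
  rewrite FE /F0; elim/big_ind: _ => [|_ _ [x xJ ->] [z zJ ->]|q _] //.
    by exists 0; rewrite ?rpred0 ?rmorph0.
  by exists (x + z); rewrite ?rpredD ?rmorphD.
have comp q : exists m, qr (e q.1 * x * e q.2) = f q m.
  case: q => j i; apply/fE; apply: zspan_gen; exists (e j), x, (e i).
  by split=> //; exists 1; apply: eP.
exists (fun q => projT1 (cid (comp q))).
rewrite FE /F0 (eq_bigr (fun q => qr (e q.1 * x * e q.2))) => [|q _]; last first.
  by case: (cid (comp q)).
(* [E] is 1 modulo [r], so [x] is the sum of the [e j * x * e i] modulo [r^2]. *)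
pose E := \sum_l e l.
have E1 : qj E = qj 1.
  apply: th_inj; rewrite !rmorph1 !rmorph_sum [RHS]sringE.
  by apply: eq_bigr => l _; apply: eP.
rewrite -[x in LHS]mul1r -[_ * x in LHS]mulr1 !rmorphM -(qr_jacobson_congl E1 xJ).
rewrite -[qr E * qr x]rmorphM -(qr_jacobson_congr E1) ?ideal2Ml //.
rewrite -!rmorphM /E mulr_suml mulr_suml rmorph_sum.
rewrite -(pair_bigA _ (fun j i => qr (e j * x * e i))).
by apply: eq_bigr => j _; rewrite mulr_sumr rmorph_sum.
Qed.
End SpeciesData.

Lemma species_of_unique (k : fieldType) (A : kalgType k) (S S' : species k) :
  is_species_of A S -> is_species_of A S' -> alg_iso (tensor_alg S) (tensor_alg S').
Proof.
move=> /species_of_smod[th [F [[thk th_bij] F_inj F_im Fl Fr]]].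
move=> /species_of_smod[th' [F' [[thk' th_bij'] F_inj' F_im' Fl' Fr']]].
have [g [thK gK]] := rmorphism_inverse th_bij.
(* [F] and the injective map [F'] have the same image [r/r^2], so [F] factors through [F']. *)
have [h1 h1E] : {h1 & forall m : smod S, F' (h1 m) = F m}.
  apply: (choice (P := fun m m' => F' m' = F m)) => m.
  have /F_im' [m' ->] : exists2 x, x \in jacobson A & F m = qpi _ x by apply/F_im; exists m.
  by exists m'.
have [g1 g1E] : {g1 & forall m : smod S', F (g1 m) = F' m}.
  apply: (choice (P := fun m m' => F m' = F' m)) => m.
  have /F_im [m' ->] : exists2 x, x \in jacobson A & F' m = qpi _ x by apply/F_im'; exists m.
  by exists m'.
have h1B : zmod_morphism h1 by move=> x y; apply: F_inj'; rewrite raddfB !h1E raddfB.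
have [h1' h1'E] := additive_exists h1B.
pose h0 : {rmorphism sring S -> sring S'} := th' \o g.
have h0E d : exists2 a, d = th (qpi _ a) & h0 d = th' (qpi _ a).
  by have [a Ea] := qpi_surj (g d); exists a; rewrite /h0 /= -Ea ?gK.
apply: (talg_iso (M := smod_bimod S) (M' := smod_bimod S') (h0 := h0) (h1 := h1')).
- by move=> c; rewrite /h0 /= -thk thK thk'.
- by apply: bij_comp th_bij' _; exists th.
- apply: (eq_bij (f := h1)) => [|m]; last by rewrite h1'E.
  by exists g1 => m; [apply: F_inj | apply: F_inj']; rewrite ?g1E ?h1E ?g1E.
- move=> d m; have [a -> ->] := h0E d; rewrite !h1'E; apply: F_inj'.
  by rewrite h1E [LHS]Fl [RHS]Fl' h1E.
- move=> m d; have [a -> ->] := h0E d; rewrite !h1'E; apply: F_inj'.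
  by rewrite h1E [LHS]Fr [RHS]Fr' h1E.
Qed.

(** The species of [L] is determined only up to isomorphism; hence the second isomorphism is
    expressed by the existence of such a species and an isomorphism for each of them. *)
Theorem corollary5p6 (k : fieldType) (L : falgType k) (Sm : species k)
    (T : Type) (rho : T -> relation Sm) :
  hereditary L -> basic L -> split_alg L ->
  no_oriented_cycle Sm ->
  strong_canonical_set rho ->
  alg_iso L (quot_alg (rel_ideal rho)) ->
  is_tree Sm ->
  alg_iso L (tensor_alg Sm) /\
  (exists SL : species k, is_species_of L SL) /\
  (forall SL : species k, is_species_of L SL ->
     alg_iso (tensor_alg Sm) (tensor_alg SL)).
Proof.
move=> hL _ _ acyc [rhoP _] Liso tree.
have I2 x : x \in rel_ideal rho -> x \in tge (smod_bimod Sm) 2.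
  move=> /ideal_genP/(_ (tge (smod_bimod Sm) 2)); apply=> _ [t ->].
  exact: relation_tge2.
have LT : alg_iso L (tensor_alg Sm).
  apply: (alg_iso_trans Liso); apply: alg_iso_sym.
  exact/quot_alg0_iso/(hereditary_ideal_eq0 hL acyc I2 Liso).
have SmL := species_of_iso acyc LT.
split=> //; split; first by exists Sm.
by move=> SL; apply: species_of_unique.
Qed.
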